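(* Let $p,p_3,p_4$ be primes such that $p\neq p_4$ and $p$ divides $p_3-1$, and let $d$ be a positive integer dividing both $p-1$ and $p_4-1$. Let $M\le\mathrm{Aut}(\mathbb Z_{p^2p_3})$ be a cyclic group of order $pd$ such that $|M_p|=pd$ and $|M_{p_3}|=p$, and let $M_1,M_2\le\mathrm{Aut}(\mathbb Z_{pp_4})$ be cyclic groups of order $d$ such that $|(M_i)_p|=|(M_i)_{p_4}|=d$ for $i=1,2$. Put $$\mathcal A_1=\mathrm{Cyc}(M,p^2p_3),\qquad \mathcal A_2=\mathrm{Cyc}(M_1,pp_4)\wr_{p_4}\mathrm{Cyc}(M_2,pp_4),\qquad \mathcal A=\mathcal A_1\wr_{p^2}\mathcal A_2,$$ so that $\mathcal A$ is an S-ring over $\mathbb Z_{p^2p_3p_4}$. If $M_1\ne M_2$, then the S-ring $\mathcal A$ is non-schurian.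
   Context: For a finite group $G$, an S-ring over $G$ is a subring $\mathcal A$ of $\mathbb Z G$ with a $\mathbb Z$-basis $\{\sum_{x\in X}x: X\in\mathcal S(\mathcal A)\}$, where $\mathcal S(\mathcal A)$ is a partition of $G$ such that the identity forms a class and $X^{-1}\in\mathcal S(\mathcal A)$ for all $X\in\mathcal S(\mathcal A)$; the classes are the basic sets. An $\mathcal A$-subgroup is a subgroup that is a union of basic sets. For $\mathcal A$-subgroups $L\trianglelefteq U$, $\mathcal A_{U/L}$ is the S-ring over $U/L$ whose basic sets are the images of the basic sets contained in $U$ ($\mathcal A_U$ when $L$ is trivial). $\mathcal A$ is schurian if there is $\Gamma\le\mathrm{Sym}(G)$ whose orbits on $G\times G$ are exactly the relations $\{(g,xg):g\in G,x\in X\}$, $X\in\mathcal S(\mathcal A)$. $\mathbb Z_n$ is the additive group of integers modulo $n$. For $m\mid n$, the subgroup of $\mathbb Z_n$ of order $m$ is identified with $\mathbb Z_m$ via $\mathbb Z_m\to\mathbb Z_n$, $1\mapsto n/m$, and the quotient of $\mathbb Z_n$ of order $m$ is identified with $\mathbb Z_m$ via the epimorphism $\mathbb Z_n\to\mathbb Z_m$, $1\mapsto 1$. Thus every section of $\mathbb Z_n$ of order $m$ is identified with $\mathbb Z_m$. For $K\le\mathrm{Aut}(\mathbb Z_n)$, $\mathrm{Cyc}(K,n)$ is the S-ring over $\mathbb Z_n$ whose basic sets are the orbits of $K$ on $\mathbb Z_n$. For a prime $q\mid n$, $K_q$ is the image of $K$ under the projection of $\mathrm{Aut}(\mathbb Z_n)=\prod_{q}\mathrm{Aut}(P_q)$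 onto $\mathrm{Aut}(P_q)$, where $P_q$ is the Sylow $q$-subgroup of $\mathbb Z_n$. Let $\mathcal B_l$ be an S-ring over $\mathbb Z_{n_l}$, $l=1,2$, and let $m$ divide both $n_1$ and $n_2$, and suppose that the subgroup of order $n_1/m$ is a $\mathcal B_1$-subgroup, the subgroup of order $m$ is a $\mathcal B_2$-subgroup, and the S-ring induced by $\mathcal B_1$ on the quotient of $\mathbb Z_{n_1}$ of order $m$ equals the restriction of $\mathcal B_2$ to the subgroup of $\mathbb Z_{n_2}$ of order $m$ (as S-rings over $\mathbb Z_m$). Then $\mathcal B_1\wr_m\mathcal B_2$ denotes the unique S-ring $\mathcal B$ over $G=\mathbb Z_{n_1n_2/m}$ such that, for the subgroups $U$ of order $n_1$ and $L$ of order $n_1/m$: $U,L$ are $\mathcal B$-subgroups, $\mathcal B_U=\mathcal B_1$, $\mathcal B_{G/L}=\mathcal B_2$, and every basic set of $\mathcal B$ contained in $G\setminus U$ is a union of $L$-cosets. (For the S-rings in the claim these compatibility conditions are satisfied, so that $\mathcal A_2$, over $\mathbb Z_{p^2p_4}$, and $\mathcal A$ are well defined.) *)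

(* Defs.v *)
From HB Require Import structures.
From mathcomp Require Import all_boot all_order all_algebra all_fingroup all_solvable.

Set Implicit Arguments.
Unset Strict Implicit.
Unset Printing Implicit Defensive.

Import GRing.Theory.

Section GroupRing.
Variable gT : finGroupType.

Definition zgring := {ffun gT -> int}.

Definition zg_one : zgring := [ffun x => (x == 1%g)%:R]%R.

Definition zg_mul (f h : zgring) : zgring :=
  [ffun x => \sum_(y : gT) f y * h (y^-1 * x)%g]%R.

Definition zg_sum (X : {set gT}) : zgring := [ffun x => (x \in X)%:R]%R.

Definition zg_span (S : {set {set gT}}) (f : zgring) : Prop :=
  exists c : {set gT} -> int, f = (\sum_(X in S) zg_sum X *~ c X)%R.

Definition zg_subring (A : zgring -> Prop) : Prop :=
  [/\ A zg_one,
      forall f h, A f -> A h -> A (f - h)%R &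
      forall f h, A f -> A h -> A (zg_mul f h)].

(* An S-ring is represented by its set S of basic sets; the subring of Z[gT]
   is then zg_span S.  The elements zg_sum X, X in S, are automatically
   Z-linearly independent, because S is a partition. *)
Definition is_sring (S : {set {set gT}}) : Prop :=
  [/\ partition S [set: gT],
      [set 1%g] \in S,
      forall X, X \in S -> (X^-1)%g \in S &
      zg_subring (zg_span S)].

Definition sring_subgroup (S : {set {set gT}}) (H : {group gT}) : Prop :=
  H = \bigcup_(X in S | X \subset H) X :> {set gT}.

Definition basic_rel (X : {set gT}) : {set gT * gT} :=
  [set (g, (x * g)%g) | g in [set: gT], x in X].

Definition pair_orbit (Gamma : {group {perm gT}}) (u : gT * gT) :
    {set gT * gT} :=
  [set (s u.1, s u.2) | s : {perm gT} in Gamma].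

Definition schurian (S : {set {set gT}}) : Prop :=
  exists Gamma : {group {perm gT}},
    pair_orbit Gamma @: [set: gT * gT] = basic_rel @: S.

End GroupRing.

(* 'Z_n stands for the integers modulo n only if n > 1, and the definitions
   below are meant for moduli greater than 1.  Group notation on 'Z_n refers
   to addition. *)

(* The subgroup of order k, for k dividing n. *)
Definition Zsub (n k : nat) : {group 'Z_n} := <[inZp (n %/ k) : 'Z_n]>%G.

(* The embedding 1 |-> n / m and the epimorphism 1 |-> 1, for m dividing n. *)
Definition Zemb (m n : nat) (x : 'Z_m) : 'Z_n := inZp (x * (n %/ m)).
Definition Zquo (n m : nat) (x : 'Z_n) : 'Z_m := inZp x.
Arguments Zemb : clear implicits.
Arguments Zquo : clear implicits.

(* The restriction to the subgroup of order m and the S-ring induced on the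
   quotient of order m, both transported to 'Z_m. *)
Definition sring_restr (n m : nat) (S : {set {set 'Z_n}}) : {set {set 'Z_m}} :=
  [set Zemb m n @^-1: X | X : {set 'Z_n} in S & X \subset Zsub n m].
Definition sring_quo (n m : nat) (S : {set {set 'Z_n}}) : {set {set 'Z_m}} :=
  [set Zquo n m @: X | X : {set 'Z_n} in S].
Arguments sring_restr : clear implicits.
Arguments sring_quo : clear implicits.

Definition Cyc (n : nat) (K : {group {perm 'Z_n}}) : {set {set 'Z_n}} :=
  [set orbit 'P K x | x : 'Z_n].

(* For K contained in Aut 'Z_n, the projection on Aut P_q is the restriction of
   automorphisms to the Sylow q-subgroup P_q = 'O_q('Z_n). *)
Definition Aut_proj (n q : nat) (K : {group {perm 'Z_n}}) :
    {set {perm 'Z_n}} :=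
  (restr_perm 'O_q([set: 'Z_n]) @* K)%g.
Arguments Cyc : clear implicits.
Arguments Aut_proj : clear implicits.

Definition gwreath_compat (n1 n2 m : nat)
    (B1 : {set {set 'Z_n1}}) (B2 : {set {set 'Z_n2}}) : Prop :=
  [/\ is_sring B1 /\ is_sring B2,
      m %| n1 /\ m %| n2,
      sring_subgroup B1 (Zsub n1 (n1 %/ m)),
      sring_subgroup B2 (Zsub n2 m) &
      sring_quo n1 m B1 = sring_restr n2 m B2].
Arguments gwreath_compat : clear implicits.

(* B is the generalized wreath product of B1 and B2 over m.  The order
   n = n1 * n2 / m of its group is a separate parameter so that it can be given
   in any form. *)
Definition is_gwreath (n1 n2 m n : nat)
    (B1 : {set {set 'Z_n1}}) (B2 : {set {set 'Z_n2}}) (B : {set {set 'Z_n}}) :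
    Prop :=
  let U := Zsub n n1 in
  let L := Zsub n (n1 %/ m) in
  [/\ gwreath_compat n1 n2 m B1 B2 /\ n = n1 * n2 %/ m,
      is_sring B,
      sring_subgroup B U /\ sring_subgroup B L,
      sring_restr n n1 B = B1 /\ sring_quo n n2 B = B2 &
      forall X, X \in B -> X \subset ~: U ->
        X = \bigcup_(x in X) (x *: L)%g].
Arguments is_gwreath : clear implicits.

(* Main.v *)
Require Import Defs.
From HB Require Import structures.
From mathcomp Require Import all_boot all_order all_algebra all_fingroup all_solvable.

Set Implicit Arguments.
Unset Strict Implicit.
Unset Printing Implicit Defensive.

Import GRing.Theory.

(* Let [U] and [L] be the subgroups of orders [p^2 p3] and [p3] of [Z_(p^2 p3 p4)].

   The functions that are constant on the classes of a generalized wreath product of [B1]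
   and [B2] are the sums of a [B1]-function supported on the subgroup and a [B2]-function
   pulled back from the quotient; such sums are closed under convolution, which gives
   existence.

   Non-schurity: if [A] is schurian, then for every [m] in [M] some permutation [g]
   preserving all the basic relations fixes [0] and multiplies the generator [1] of [U]
   by [m].  Let [P] be an element of order [p] of [U].  Then [g P = m' P], and
   [m' P - m = m'' (P - 1)] with [m', m''] in [M]; modulo [p] and modulo [p3] this says
   that [m] and [m''] agree, hence [m'' = m] and [g P = m P].  Modulo [L], let [Q] have
   order [p4].  Comparing [Q] with [P] in the subgroup of order [p p4] shows that [g]
   multiplies [Q] by the element of [M1] that agrees with [m] modulo [p]; comparing [Q]
   with the generator of [U] in the quotient of order [p p4] shows the same for [M2].
   Every residue modulo [p] of an element of [M1] comes from some [m] in [M], so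
   [M1 = M2]. *)

(** * Partitions of a finite set *)

Section Partitions.
Variable T : finType.
Implicit Types (S : {set {set T}}) (X : {set T}).

Lemma partition_class S x : partition S setT ->
  exists2 X, X \in S & x \in X.
Proof.
case/and3P=> /eqP covS _ _.
have: x \in cover S by rewrite covS inE.
by case/bigcupP=> X; exists X.
Qed.

Lemma partition_eq S X Y x : partition S setT ->
  X \in S -> Y \in S -> x \in X -> x \in Y -> X = Y.
Proof.
case/and3P=> _ triv _ XS YS xX xY.
by rewrite -(def_pblock triv XS xX) (def_pblock triv YS xY).
Qed.

Lemma partition_neq0 S X : partition S setT -> X \in S -> exists x, x \in X.
Proof.
case/and3P=> _ _ S0 XS; apply/set0Pn; apply: contraNneq S0 => <-; exact: XS.
Qed.

Lemma partition_intro S :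
  (forall X, X \in S -> exists x, x \in X) ->
  (forall x, exists2 X, X \in S & x \in X) ->
  (forall X Y x, X \in S -> Y \in S -> x \in X -> x \in Y -> X = Y) ->
  partition S setT.
Proof.
move=> ne cov inj; apply/and3P; split.
- rewrite eqEsubset subsetT; apply/subsetP=> x _.
  by have [X XS xX] := cov x; apply/bigcupP; exists X.
- apply/trivIsetP=> X Y XS YS; apply: contraNT => /pred0Pn[x /andP[xX xY]].
  by apply/eqP; apply: inj xX xY.
- by apply/negP=> /ne[x]; rewrite inE.
Qed.

(** A block of [S'] is nonempty, hence meets a block of [S], which is itself a block of [S']; the
    two then coincide. Uniqueness statements thereby need only one inclusion. *)
Lemma sub_partition S S' : partition S setT -> partition S' setT ->
  S \subset S' -> S = S'.
Proof.
move=> pS pS' /subsetP sub; apply/eqP; rewrite eqEsubset; apply/andP.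
split; apply/subsetP=> // X XS'.
have [x xX] := partition_neq0 pS' XS'.
have [Y YS xY] := partition_class x pS.
by rewrite (partition_eq pS' XS' (sub _ YS) xX xY).
Qed.

End Partitions.

(** * S-rings as rings of functions constant on classes *)

Section ClassFunctions.
Variable gT : finGroupType.
Implicit Types (S : {set {set gT}}) (X : {set gT}) (f h : zgring gT).

Definition class_const S f :=
  forall X x y, X \in S -> x \in X -> y \in X -> f x = f y.

(** The coefficient of a class is the common value of the function on it. Closure under convolution
    can then be checked pointwise, without structure constants. *)
Lemma zg_spanP S f : partition S setT -> zg_span S f <-> class_const S f.
Proof.
move=> pS; have [_ triv _] := and3P pS; split.
  case=> c -> X x y XS xX yX.
  have val z : z \in X -> (\sum_(Y in S) zg_sum Y *~ c Y)%R z = c X.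
    move=> zX; rewrite sum_ffunE (bigD1 X) //= big1 ?addr0.
      by rewrite ffunMzE !ffunE zX intz.
    move=> Y /andP[YS YX]; rewrite ffunMzE !ffunE.
    case: (boolP (z \in Y)) => [zY|_]; last by rewrite mul0rz.
    by rewrite (partition_eq pS YS XS zY zX) eqxx in YX.
  by rewrite !val.
move=> cf; exists (fun X => f (repr X)); apply/ffunP=> x.
have [X XS xX] := partition_class x pS.
rewrite sum_ffunE (bigD1 X) //= big1 ?addr0.
  by rewrite ffunMzE !ffunE xX intz; apply: cf XS _ _ => //; apply: mem_repr xX.
move=> Y /andP[YS YX]; rewrite ffunMzE !ffunE.
case: (boolP (x \in Y)) => [xY|_]; last by rewrite mul0rz.
by rewrite (partition_eq pS YS XS xY xX) eqxx in YX.
Qed.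

Lemma class_constB S f h :
  class_const S f -> class_const S h -> class_const S (f - h)%R.
Proof.
by move=> cf ch X x y XS xX yX; rewrite !ffunE (cf _ _ _ XS xX yX) (ch _ _ _ XS xX yX).
Qed.

Lemma class_constD S f h :
  class_const S f -> class_const S h -> class_const S (f + h)%R.
Proof.
by move=> cf ch X x y XS xX yX; rewrite !ffunE (cf _ _ _ XS xX yX) (ch _ _ _ XS xX yX).
Qed.

Lemma is_sring_intro S : partition S setT -> [set 1%g] \in S ->
  (forall X, X \in S -> (X^-1)%g \in S) ->
  (forall f h, class_const S f -> class_const S h -> class_const S (zg_mul f h)) ->
  is_sring S.
Proof.
move=> pS S1 SV SM; split=> //; split.
- apply/zg_spanP=> // X x y XS xX yX; rewrite !ffunE.
  have E z : z \in X -> (z == 1%g) = (X == [set 1%g]).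
    move=> zX; apply/eqP/eqP => [z1|X1]; last by apply/set1P; rewrite -X1.
    by apply: (partition_eq pS XS S1 zX); rewrite z1 set11.
  by rewrite !E.
- by move=> f h /(zg_spanP _ pS) cf /(zg_spanP _ pS) ch; apply/zg_spanP/class_constB.
- by move=> f h /(zg_spanP _ pS) cf /(zg_spanP _ pS) ch; apply/zg_spanP/SM.
Qed.

Lemma is_sring_mul S f h : is_sring S ->
  class_const S f -> class_const S h -> class_const S (zg_mul f h).
Proof.
case=> pS _ _ [_ _ SM] cf ch; apply/(zg_spanP _ pS).
by apply: SM; apply/zg_spanP.
Qed.

(** Replaces the equality of sets by a transfer of membership along a class, which is the form used
    throughout. *)
Lemma sring_subgroupP S (H : {group gT}) : partition S setT ->
  sring_subgroup S H <->
  (forall X x y, X \in S -> x \in X -> y \in X -> x \in H -> y \in H).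
Proof.
move=> pS; split=> [eqH X x y XS xX yX|clH].
  rewrite [in x \in _]eqH => /bigcupP[Y /andP[YS YH] xY].
  by apply: (subsetP YH); rewrite -(partition_eq pS XS YS xX xY).
rewrite /sring_subgroup; apply/eqP; rewrite eqEsubset; apply/andP; split.
  apply/subsetP=> x xH.
  have [X XS xX] := partition_class x pS; apply/bigcupP; exists X => //; rewrite XS /=.
  by apply/subsetP=> y yX; apply: clH XS xX yX xH.
by apply/bigcupsP=> X /andP[].
Qed.

Lemma sring_subgroup_sub S (H : {group gT}) X x : partition S setT ->
  sring_subgroup S H -> X \in S -> x \in X -> (X \subset H) = (x \in H).
Proof.
move=> pS /(sring_subgroupP _ pS) clH XS xX; apply/idP/idP => [/subsetP/(_ _ xX)//|xH].
by apply/subsetP=> y yX; apply: clH XS xX yX xH.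
Qed.

End ClassFunctions.

(** * Convolution, push-forward and pull-back *)

Section Convolution.

Definition zg_push (gT hT : finGroupType) (phi : gT -> hT) (f : zgring gT) :
    zgring hT := [ffun y => \sum_(x | phi x == y) f x]%R.
Definition zg_pull (gT hT : finGroupType) (phi : gT -> hT) (f : zgring hT) :
    zgring gT := [ffun x => f (phi x)].

Variable gT : finGroupType.
Implicit Types (f h : zgring gT).

Lemma zg_mulDl f1 f2 h : zg_mul (f1 + f2)%R h = (zg_mul f1 h + zg_mul f2 h)%R.
Proof.
by apply/ffunP=> x; rewrite !ffunE -big_split; apply: eq_bigr => y _; rewrite ffunE mulrDl.
Qed.

Lemma zg_mulDr f h1 h2 : zg_mul f (h1 + h2)%R = (zg_mul f h1 + zg_mul f h2)%R.
Proof.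
by apply/ffunP=> x; rewrite !ffunE -big_split; apply: eq_bigr => y _; rewrite ffunE mulrDr.
Qed.

Hypothesis gT_abelian : forall x y : gT, (x * y = y * x)%g.

Lemma zg_mulC f h : zg_mul f h = zg_mul h f.
Proof.
apply/ffunP=> x; rewrite !ffunE (reindex_inj (inj_comp (mulgI x) invg_inj)) /=.
apply: eq_bigr => y _; rewrite mulrC; congr (h _ * f _)%R.
by rewrite invMg invgK mulgKV.
exact: gT_abelian.
Qed.

End Convolution.

Section PushPull.
Variables (gT hT : finGroupType) (phi : gT -> hT).
Hypothesis phiM : {morph phi : x y / (x * y)%g}.

Lemma morph_1 : phi 1%g = 1%g.
Proof. by apply: (mulgI (phi 1%g)); rewrite -phiM !mulg1. Qed.

Lemma morph_V x : phi x^-1%g = (phi x)^-1%g.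
Proof. by apply/esym/eqP; rewrite eq_invg_mul -phiM mulgV morph_1. Qed.

(** The map [phi] extends linearly to a homomorphism of group rings: sort the terms by the image [w]
    of the left factor. *)
Lemma zg_push_mul (f h : zgring gT) :
  zg_push phi (zg_mul f h) = zg_mul (zg_push phi f) (zg_push phi h).
Proof.
apply/ffunP=> z; rewrite !ffunE.
under eq_bigr do rewrite ffunE.
rewrite exchange_big (partition_big phi predT) //=; apply: eq_bigr => w _.
rewrite ffunE big_distrl /=; apply: eq_bigr => y /eqP yw.
rewrite ffunE big_distrr /= (reindex_inj (mulgI y)) /=.
apply: eq_big => [x|x _]; last by rewrite mulKg.
by rewrite phiM yw -(inj_eq (mulgI w^-1%g)) mulKg.
Qed.

(** The projection formula: the pulled-back factor depends on the summation variable only through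
    its image, so the sum collapses along the fibres of [phi]. *)
Lemma zg_mul_pull (f : zgring gT) (h : zgring hT) :
  zg_mul f (zg_pull phi h) = zg_pull phi (zg_mul (zg_push phi f) h).
Proof.
apply/ffunP=> x; rewrite !ffunE (partition_big phi predT) //=; apply: eq_bigr => w _.
rewrite ffunE big_distrl /=; apply: eq_bigr => y /eqP yw.
by rewrite ffunE phiM morph_V yw.
Qed.

(** The map [s] makes [phi] surjective, so every fibre is a translate of the kernel and has its
    cardinality. *)
Lemma zg_push_pull (s : hT -> gT) (h : zgring hT) : cancel s phi ->
  zg_push phi (zg_pull phi h) = (h *+ #|[set x | phi x == 1%g]|)%R.
Proof.
move=> sK; apply/ffunP=> z; rewrite ffunMnE ffunE.
rewrite (eq_bigr (fun _ => h z)) => [|x /eqP xz]; last by rewrite ffunE xz.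
rewrite sumr_const; congr (_ *+ _)%R.
rewrite -(card_preimset _ (mulgI (s z)^-1%g)); apply: eq_card => x.
rewrite [LHS]inE !inE phiM morph_V sK.
by rewrite -eq_mulVg1 eq_sym.
Qed.

Lemma zg_push_inj (f : zgring gT) x : injective phi -> zg_push phi f (phi x) = f x.
Proof.
by move=> inj; rewrite ffunE (big_pred1 x) // => y /=; rewrite inj_eq.
Qed.

Lemma zg_push_out (f : zgring gT) y : y \notin codom phi -> zg_push phi f y = 0%R.
Proof.
move=> ny; rewrite ffunE big1 // => x /eqP xy.
by rewrite -xy codom_f in ny.
Qed.

End PushPull.

(** * Generalized wreath products *)

Section GeneralizedWreath.
(* The square [pi \o iota = j \o pi'] presents [vT] as the section [U / L] of [gT],
   where [U] is the image of [iota] and [L] the kernel of [pi]; [cartesian] says that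
   [L] is contained in [U]. *)
Variables gT uT qT vT : finGroupType.
Variables (iota : uT -> gT) (pi : gT -> qT) (pi' : uT -> vT) (j : vT -> qT).
Variable sect : qT -> gT.
Hypothesis iotaM : {morph iota : x y / (x * y)%g}.
Hypothesis piM : {morph pi : x y / (x * y)%g}.
Hypothesis pi'M : {morph pi' : x y / (x * y)%g}.
Hypothesis jM : {morph j : x y / (x * y)%g}.
Hypothesis iota_inj : injective iota.
Hypothesis j_inj : injective j.
Hypothesis sectK : cancel sect pi.
Hypothesis square : forall x, pi (iota x) = j (pi' x).
Hypothesis cartesian : forall x, pi x \in codom j -> x \in codom iota.
Hypothesis gT_abelian : forall x y : gT, (x * y = y * x)%g.

Variables (B1 : {set {set uT}}) (B2 : {set {set qT}}).

(** Outside [U] the classes are full preimages under [pi], hence unions of cosets of [L]. Classes of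
    [B2] inside the image of [j] are left out, since [B1] already partitions their preimages. *)
Definition wreath_classes : {set {set gT}} :=
  [set iota @: X | X : {set uT} in B1] :|:
  [set pi @^-1: Y | Y : {set qT} in B2 & ~~ (Y \subset codom j)].

Hypothesis B1_sring : is_sring B1.
Hypothesis B2_sring : is_sring B2.
Hypothesis ker_B1 : forall X x y, X \in B1 -> x \in X -> y \in X ->
  pi' x = 1%g -> pi' y = 1%g.
Hypothesis im_B2 : forall Y x y, Y \in B2 -> x \in Y -> y \in Y ->
  x \in codom j -> y \in codom j.
Hypothesis quo_restr : [set pi' @: X | X : {set uT} in B1] =
  [set j @^-1: Y | Y : {set qT} in B2 & Y \subset codom j].

Let pB1 : partition B1 setT. Proof. by case: B1_sring. Qed.
Let pB2 : partition B2 setT. Proof. by case: B2_sring. Qed.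

Lemma codom_square x : (x \in codom iota) = (pi x \in codom j).
Proof.
apply/idP/idP => [/codomP[u ->]|/cartesian//].
by rewrite square codom_f.
Qed.

(** The image of [j] is a union of classes of [B2], so a class not contained in it is disjoint from
    it. *)
Lemma wreath_classesP X : X \in wreath_classes ->
  (exists2 X1, X1 \in B1 & X = iota @: X1) \/
  (exists Y, [/\ Y \in B2, X = pi @^-1: Y & forall y, y \in Y -> y \notin codom j]).
Proof.
case/setUP=> /imsetP[Z ZB ->]; [left | right]; first by exists Z.
move: ZB; rewrite inE => /andP[ZB nZ]; exists Z; split=> // y yZ.
apply: contra nZ => yj; apply/subsetP=> z zZ; exact: im_B2 ZB yZ zZ yj.
Qed.

Lemma wreath_class_in X1 : X1 \in B1 -> iota @: X1 \in wreath_classes.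
Proof. by move=> XB; apply/setUP; left; apply: imset_f. Qed.

Lemma wreath_class_out Y y : Y \in B2 -> y \in Y -> y \notin codom j ->
  pi @^-1: Y \in wreath_classes.
Proof.
move=> YB yY yj; apply/setUP; right; apply: imset_f; rewrite inE YB.
by apply: contra yj => /subsetP/(_ _ yY).
Qed.

Lemma wreath_partition : partition wreath_classes setT.
Proof.
apply: partition_intro.
- move=> X /wreath_classesP[[X1 XB ->]|[Y [YB -> _]]].
    by have [x xX] := partition_neq0 pB1 XB; exists (iota x); apply: imset_f.
  by have [y yY] := partition_neq0 pB2 YB; exists (sect y); rewrite inE sectK.
- move=> x; have [/codomP[u ->]|nx] := boolP (x \in codom iota).
    have [X XB uX] := partition_class u pB1.
    by exists (iota @: X); [apply: wreath_class_in | apply: imset_f].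
  have [Y YB xY] := partition_class (pi x) pB2.
  exists (pi @^-1: Y); last by rewrite inE.
  by apply: wreath_class_out YB xY _; rewrite -codom_square.
(* By the commutative square, a preimage of a class avoiding the image of [j] avoids the image of
   [iota], so classes of the two kinds never meet. *)
- have out (Y : {set qT}) u : {in Y, forall y, y \notin codom j} -> iota u \in pi @^-1: Y -> False.
    by move=> nY; rewrite inE square => /nY; rewrite codom_f.
  move=> X Z x /wreath_classesP[[X1 XB ->]|[Y [YB -> nY]]].
    move=> /wreath_classesP[[Z1 ZB ->]|[Y [YB -> nY]]].
      case/imsetP=> u uX -> /imsetP[v vZ /iota_inj uv]; rewrite -uv in vZ.
      by rewrite (partition_eq pB1 XB ZB uX vZ).
    by case/imsetP=> u _ -> /out-/(_ nY).
  move=> /wreath_classesP[[Z1 ZB ->]|[Z1 [ZB -> _]]].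
    by move=> xY /imsetP[u _ xu]; rewrite xu in xY; case: (out _ _ nY xY).
  by rewrite !inE => xY xZ; rewrite (partition_eq pB2 YB ZB xY xZ).
Qed.

(** Inside [U] this rests on [quo_restr]: the image in [vT] of a class of [B1] is the trace of a
    single class of [B2]. *)
Lemma class_const_pull (g : zgring qT) : class_const B2 g ->
  class_const wreath_classes (zg_pull pi g).
Proof.
move=> cg X x y /wreath_classesP[[X1 XB ->]|[Y [YB -> _]]]; rewrite !ffunE.
  case/imsetP=> u uX -> /imsetP[v vX ->]; rewrite !square.
  have: pi' @: X1 \in [set pi' @: X | X : {set uT} in B1] by apply: imset_f.
  rewrite quo_restr => /imsetP[Y]; rewrite inE => /andP[YB _] eY.
  have inY w : w \in X1 -> j (pi' w) \in Y.
    by move=> wX; have := imset_f pi' wX; rewrite eY inE.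
  exact: cg YB (inY _ uX) (inY _ vX).
by rewrite !inE; apply: cg.
Qed.

Lemma class_const_push (a : zgring uT) : class_const B1 a ->
  class_const wreath_classes (zg_push iota a).
Proof.
move=> ca X x y /wreath_classesP[[X1 XB ->]|[Y [YB -> nY]]].
  by case/imsetP=> u uX -> /imsetP[v vX ->]; rewrite !zg_push_inj //; apply: ca uX vX.
by rewrite !inE => /nY xj /nY yj; rewrite !zg_push_out // codom_square.
Qed.

Lemma class_const_decomp (f : zgring gT) : class_const wreath_classes f ->
  exists a g, [/\ class_const B1 a, class_const B2 g &
                  f = zg_push iota a + zg_pull pi g]%R.
Proof.
move=> cf; exists (zg_pull iota f).
(* The second summand vanishes over [U], so the first one carries all values there; outside [U] any
   lift of [q] gives the same value, because the classes are full preimages. *)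
exists [ffun q => if q \in codom j then 0%R else f (sect q)]; split.
- move=> X x y XB xX yX; rewrite !ffunE.
  by apply: cf (wreath_class_in XB) _ _; apply: imset_f.
- move=> Y x y YB xY yY; rewrite !ffunE.
  have [xj|nx] := boolP (x \in codom j); first by rewrite (im_B2 YB xY yY xj).
  have ny : y \notin codom j by apply: contra nx; apply: im_B2 YB yY xY.
  rewrite (negPf ny).
  by apply: cf (wreath_class_out YB xY nx) _ _; rewrite inE sectK.
- apply/ffunP=> x; rewrite [RHS]ffunE.
  have [/codomP[u ->]|nx] := boolP (x \in codom iota).
    by rewrite zg_push_inj // !ffunE square codom_f addr0.
  rewrite zg_push_out // add0r !ffunE.
  have nj : pi x \notin codom j by rewrite -codom_square.
  rewrite (negPf nj).
  have [Y YB xY] := partition_class (pi x) pB2.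
  by apply: cf (wreath_class_out YB xY nj) _ _; rewrite inE ?sectK.
Qed.

(* Pushing forward to [vT] amounts to convolving with the indicator of the
   kernel of [pi'], and [ker_B1] says that this indicator lies in the S-ring. *)
Lemma class_const_push_quo (a : zgring uT) : class_const B1 a ->
  class_const B2 (zg_push j (zg_push pi' a)).
Proof.
move=> ca Y x y YB xY yY.
have [xj|nx] := boolP (x \in codom j); last first.
  have ny : y \notin codom j by apply: contra nx; apply: im_B2 YB yY xY.
  by rewrite !zg_push_out.
have Yj : Y \subset codom j by apply/subsetP=> z zY; apply: im_B2 YB xY zY xj.
have: j @^-1: Y \in [set pi' @: X | X : {set uT} in B1].
  by rewrite quo_restr; apply: imset_f; rewrite inE YB.
case/imsetP=> X XB eX.
have lift z : z \in Y -> exists2 u, u \in X & z = j (pi' u).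
  move=> zY; have /codomP[v zv] := subsetP Yj _ zY.
  have: v \in j @^-1: Y by rewrite inE -zv.
  by rewrite eX => /imsetP[u uX vu]; exists u => //; rewrite zv vu.
have [u uX ->] := lift x xY; have [v vX ->] := lift y yY.
rewrite !(zg_push_inj _ _ j_inj).
pose k : zgring uT := [ffun w => (pi' w == 1%g)%:R]%R.
have ck : class_const B1 k.
  move=> Z z w ZB zZ wZ; rewrite !ffunE; congr (_%:R)%R; congr (nat_of_bool _).
  by apply/eqP/eqP; apply: ker_B1 ZB _ _.
have E w : zg_push pi' a (pi' w) = zg_mul a k w.
  rewrite !ffunE big_mkcond; apply: eq_bigr => z _.
  rewrite !ffunE pi'M (morph_V pi'M) -eq_mulVg1.
  by case: eqP => _; rewrite ?mulr1 ?mulr0.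
by rewrite !E; apply: (is_sring_mul B1_sring ca ck) XB uX vX.
Qed.

(** Decomposing both factors gives four products. Two push-forwards multiply to a push-forward; the
    mixed products are pull-backs by the projection formula; two pull-backs give a pull-back scaled
    by the order of the kernel of [pi]. *)
Lemma wreath_mul (f h : zgring gT) :
  class_const wreath_classes f -> class_const wreath_classes h ->
  class_const wreath_classes (zg_mul f h).
Proof.
move=> /class_const_decomp[a [g [ca cg ->]]] /class_const_decomp[b [k [cb ck ->]]].
(* Pushing forward through [gT] equals pushing forward through [vT], by the square. *)
have push_cc c : class_const B1 c -> class_const B2 (zg_push pi (zg_push iota c)).
  move=> cc; suff ->: zg_push pi (zg_push iota c) = zg_push j (zg_push pi' c).
    exact: class_const_push_quo.
  have comp (xT yT zT : finGroupType) (phi : xT -> yT) (psi : yT -> zT) e z :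
      zg_push psi (zg_push phi e) z = (\sum_(x | psi (phi x) == z) e x)%R.
    rewrite ffunE (partition_big phi (fun y => psi y == z)) //.
    apply: eq_bigr => y /eqP yz; rewrite ffunE; apply: eq_bigl => x.
    by case: eqP => [->|]; rewrite ?yz ?eqxx ?andbF.
  by apply/ffunP=> z; rewrite !comp; apply: eq_bigl => x; rewrite square.
rewrite !zg_mulDl !zg_mulDr -(zg_push_mul iotaM) (zg_mulC gT_abelian (zg_pull pi g)).
rewrite !(zg_mul_pull piM) (zg_push_pull piM _ sectK).
apply: class_constD; apply: class_constD.
- exact/class_const_push/is_sring_mul.
- by apply/class_const_pull/is_sring_mul => //; apply: push_cc.
- by apply/class_const_pull/is_sring_mul => //; apply: push_cc.
- apply/class_const_pull/is_sring_mul => //.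
  by move=> Y x y YB xY yY; rewrite !ffunMnE (cg Y x y).
Qed.

Lemma wreath_sring : is_sring wreath_classes.
Proof.
apply: (is_sring_intro wreath_partition); last exact: wreath_mul.
- have: [set 1%g] \in B1 by case: B1_sring.
  by move/wreath_class_in; rewrite imset_set1 (morph_1 iotaM).
move=> X /wreath_classesP[[X1 XB ->]|[Y [YB -> nY]]].
  have: (X1^-1)%g \in B1 by case: B1_sring => _ _ + _; apply.
  suff <- : iota @: (X1^-1)%g = ((iota @: X1)^-1)%g :> {set gT} by apply: wreath_class_in.
  apply/setP=> x; rewrite inE; apply/imsetP/imsetP => [[u uX ->]|[u uX xu]]; exists (u^-1)%g.
  - by rewrite inE in uX.
  - by rewrite (morph_V iotaM).
  - by rewrite inE invgK.
  - by rewrite (morph_V iotaM) -xu invgK.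
have VB: (Y^-1)%g \in B2 by case: B2_sring => _ _ + _; apply.
have [y yV] := partition_neq0 pB2 VB.
have yj : y \notin codom j.
  move: yV; rewrite inE => /nY; apply: contra => /codomP[v ->].
  by rewrite -(morph_V jM) codom_f.
suff <- : pi @^-1: (Y^-1)%g = ((pi @^-1: Y)^-1)%g :> {set gT}.
  exact: wreath_class_out VB yV yj.
by apply/setP=> x; rewrite !inE (morph_V piM).
Qed.

Lemma wreath_im X x y : X \in wreath_classes -> x \in X -> y \in X ->
  x \in codom iota -> y \in codom iota.
Proof.
move=> /wreath_classesP[[X1 XB ->]|[Y [YB -> nY]]].
  by move=> _ /imsetP[v _ ->]; rewrite codom_f.
by rewrite inE => /nY; rewrite codom_square => /negPf ->.
Qed.

Lemma wreath_ker X x y : X \in wreath_classes -> x \in X -> y \in X ->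
  pi x = 1%g -> pi y = 1%g.
Proof.
move=> /wreath_classesP[[X1 XB ->]|[Y [YB -> nY]]].
  move=> /imsetP[u uX ->] /imsetP[v vX ->].
  rewrite !square -(morph_1 jM) => /j_inj u1; congr j; exact: ker_B1 XB uX vX u1.
rewrite !inE => /nY + _ x1; rewrite x1 => /negP[].
by rewrite -(morph_1 jM) codom_f.
Qed.

Lemma wreath_restr :
  [set iota @^-1: X | X : {set gT} in wreath_classes & X \subset codom iota] = B1.
Proof.
have pre (X : {set uT}) : iota @^-1: (iota @: X) = X.
  by apply/setP=> u; rewrite inE mem_imset.
apply/setP=> X; apply/imsetP/idP => [[Z]|XB].
  rewrite inE => /andP[/wreath_classesP[[X1 XB ->] _ ->|[Y [YB -> nY]] sub _]].
    by rewrite pre.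
  have [y yY] := partition_neq0 pB2 YB.
  have: sect y \in codom iota by apply: (subsetP sub); rewrite inE sectK.
  by rewrite codom_square sectK (negPf (nY _ yY)).
exists (iota @: X); rewrite ?pre // inE wreath_class_in //=.
by apply/subsetP=> _ /imsetP[u _ ->]; apply: codom_f.
Qed.

(** Classes outside [U] return the class of [B2] they came from; for those inside, [quo_restr]
    matches their images with the classes of [B2] in the image of [j]. *)
Lemma wreath_quo : [set pi @: X | X : {set gT} in wreath_classes] = B2.
Proof.
have out (Y : {set qT}) : pi @: (pi @^-1: Y) = Y.
  apply/setP=> y; apply/imsetP/idP => [[x xY ->]|yY]; first by rewrite inE in xY.
  by exists (sect y); rewrite ?inE sectK.
have inn (X : {set uT}) : pi @: (iota @: X) = j @: (pi' @: X).
  by rewrite -!imset_comp; apply: eq_imset.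
have back (Y : {set qT}) : Y \subset codom j -> j @: (j @^-1: Y) = Y.
  move=> sub; apply/setP=> y; apply/imsetP/idP => [[v vY ->]|yY]; first by rewrite inE in vY.
  by have /codomP[v yv] := subsetP sub _ yY; exists v; rewrite ?inE -?yv.
apply/setP=> Y; apply/imsetP/idP => [[X]|YB].
  case/wreath_classesP=> [[X1 XB ->]|[Z [ZB -> _]]] ->; last by rewrite out.
  have: pi' @: X1 \in [set pi' @: X | X : {set uT} in B1] by apply: imset_f.
  rewrite quo_restr inn => /imsetP[Z]; rewrite inE => /andP[ZB sub] ->.
  by rewrite back.
have [sub|nsub] := boolP (Y \subset codom j); last first.
  exists (pi @^-1: Y); rewrite ?out //; apply/setUP; right.
  by apply: imset_f; rewrite inE YB.
have: j @^-1: Y \in [set pi' @: X | X : {set uT} in B1].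
  by rewrite quo_restr; apply: imset_f; rewrite inE YB.
case/imsetP=> X XB eX; exists (iota @: X); first exact: wreath_class_in.
by rewrite inn -eX back.
Qed.

Lemma wreath_saturated X x y : X \in wreath_classes -> x \in X ->
  x \notin codom iota -> pi x = pi y -> y \in X.
Proof.
move=> /wreath_classesP[[X1 XB ->]|[Y [YB -> nY]]].
  by case/imsetP=> u _ -> /negP[]; apply: codom_f.
by rewrite !inE => + _ xy; rewrite xy.
Qed.

(** A class inside [U] is recovered from its restriction, and a class outside is the full preimage
    of its image by saturation. Hence every class of [B] is a wreath class, and [sub_partition]
    concludes. *)
Lemma wreath_unique (B : {set {set gT}}) : partition B setT ->
  (forall X x y, X \in B -> x \in X -> y \in X ->
    x \in codom iota -> y \in codom iota) ->
  [set iota @^-1: X | X : {set gT} in B & X \subset codom iota] = B1 ->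
  [set pi @: X | X : {set gT} in B] = B2 ->
  (forall X x y, X \in B -> x \in X -> x \notin codom iota ->
    pi x = pi y -> y \in X) ->
  B = wreath_classes.
Proof.
move=> pB imB restrB quoB satB; apply: (sub_partition pB wreath_partition).
apply/subsetP=> X XB; have [x xX] := partition_neq0 pB XB.
have [xi|nx] := boolP (x \in codom iota).
  have sub : X \subset codom iota by apply/subsetP=> y yX; apply: imB XB xX yX xi.
  have ->: X = iota @: (iota @^-1: X).
    apply/setP=> y; apply/idP/imsetP => [yX|[u uX ->]]; last by rewrite inE in uX.
    by have /codomP[u yu] := subsetP sub _ yX; exists u; rewrite ?inE -?yu.
  by apply: wreath_class_in; rewrite -restrB; apply: imset_f; rewrite inE XB.
have ->: X = pi @^-1: (pi @: X).
  apply/setP=> y; rewrite inE; apply/idP/imsetP => [yX|[z zX yz]]; first by exists y.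
  apply: (satB X z y XB zX _ (esym yz)).
  by apply: contra nx => zi; apply: imB XB zX xX zi.
apply: (@wreath_class_out _ (pi x)); rewrite -?codom_square ?imset_f //.
by rewrite -quoB; apply: imset_f.
Qed.

End GeneralizedWreath.

(** * Sections of cyclic groups *)

Section ModularArithmetic.

(** Together with [natr_Zp], which writes every residue as a cast, this reduces identities in ['Z_n]
    to congruences between natural numbers. *)
Lemma natr_eqP n a b : 1 < n -> (a%:R = b%:R :> 'Z_n)%R <-> a = b %[mod n].
Proof.
move=> n1; split=> [/(congr1 val)|E] /=; first by rewrite !val_Zp_nat.
by apply: val_inj => /=; rewrite !val_Zp_nat.
Qed.

Lemma Zmod_mulgC n (x y : 'Z_n) : (x * y = y * x)%g.
Proof. by rewrite !FinRing.zmodMgE addrC. Qed.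

Lemma val_Zp_lt n (x : 'Z_n) : 1 < n -> x < n.
Proof. by move=> n1; rewrite -[n in _ < n]Zp_cast. Qed.

Lemma dvd_natr n k a : 1 < n -> k %| n -> (k %| (a%:R : 'Z_n)%R) = (k %| a).
Proof. by move=> n1 kn; rewrite val_Zp_nat // /dvdn modn_dvdm. Qed.

Lemma mem_Zsub n k (x : 'Z_n) : 1 < n -> k %| n ->
  (x \in Zsub n k) = (n %/ k %| x).
Proof.
move=> n1 kn; have kn' : n %/ k %| n by rewrite -{2}(divnK kn) dvdn_mulr.
apply/cycleP/idP => [[i ->]|/dvdnP[i xi]].
  by rewrite -Zp_nat FinRing.zmodXgE -mulrnA dvd_natr ?dvdn_mulr.
by exists i; rewrite -Zp_nat FinRing.zmodXgE -mulrnA -(natr_Zp x) xi mulnC.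
Qed.

Variables n m : nat.
Hypotheses (m_gt1 : 1 < m) (n_gt0 : 0 < n) (mn : m %| n).

Let n_gt1 : 1 < n. Proof. exact: leq_trans m_gt1 (dvdn_leq n_gt0 mn). Qed.

Lemma Zemb_nat a : Zemb m n a%:R%R = (a * (n %/ m))%:R%R.
Proof.
rewrite /Zemb -Zp_nat; apply/natr_eqP => //.
by rewrite val_Zp_nat // muln_modl [m * _]mulnC divnK // modn_mod.
Qed.

Lemma Zquo_nat a : Zquo n m a%:R%R = a%:R%R.
Proof.
by rewrite /Zquo -Zp_nat; apply/natr_eqP => //; rewrite val_Zp_nat // modn_dvdm.
Qed.

Lemma Zemb_add : {morph Zemb m n : x y / (x * y)%g}.
Proof.
move=> x y; rewrite !FinRing.zmodMgE -(natr_Zp x) -(natr_Zp y) -natrD !Zemb_nat.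
by rewrite mulnDl natrD.
Qed.

Lemma Zquo_add : {morph Zquo n m : x y / (x * y)%g}.
Proof.
by move=> x y; rewrite !FinRing.zmodMgE -(natr_Zp x) -(natr_Zp y) -natrD !Zquo_nat natrD.
Qed.

Lemma Zquo_mul : {morph Zquo n m : x y / (x * y)%R}.
Proof.
by move=> x y; rewrite -(natr_Zp x) -(natr_Zp y) -natrM !Zquo_nat natrM.
Qed.

Lemma Zemb_inj : injective (Zemb m n).
Proof.
move=> x y; rewrite -(natr_Zp x) -(natr_Zp y) !Zemb_nat => /(natr_eqP _ _ n_gt1) E.
have d_gt0 : 0 < n %/ m by rewrite (divn_gt0 _ (ltnW m_gt1)) (dvdn_leq n_gt0 mn).
apply/(natr_eqP _ _ m_gt1)/eqP; rewrite -(eqn_pmul2r d_gt0).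
move: E; rewrite -{2 4}(divnK mn) [_ * m]mulnC -!muln_modl => E; apply/eqP; exact: E.
Qed.

Lemma codom_Zemb x : (x \in codom (Zemb m n)) = (n %/ m %| x).
Proof.
have d : n %/ m %| n by rewrite -{2}(divnK mn) dvdn_mulr.
apply/codomP/idP => [[y ->]|/dvdnP[i xi]].
  by rewrite -(natr_Zp y) Zemb_nat dvd_natr // dvdn_mull.
by exists i%:R%R; rewrite Zemb_nat -xi natr_Zp.
Qed.

Lemma codom_Zemb_Zsub : codom (Zemb m n) =i Zsub n m.
Proof. by move=> x; rewrite codom_Zemb mem_Zsub. Qed.

(** With [m] dividing [n], the map [Zquo m n] goes against the quotient map and picks the least
    representative; it is a set-theoretic section only. *)
Lemma Zquo_sectK : cancel (Zquo m n) (Zquo n m).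
Proof.
move=> x; rewrite /Zquo -!Zp_nat -[RHS](natr_Zp x); apply/natr_eqP => //.
by rewrite val_Zp_nat // modn_dvdm.
Qed.

Lemma Zquo_eq0 x : (Zquo n m x == 0%R) = (m %| x).
Proof.
by rewrite /Zquo -Zp_nat; apply/eqP/eqP=> [/(natr_eqP _ 0 m_gt1)|E];
   [rewrite mod0n | apply/(natr_eqP _ 0 m_gt1); rewrite mod0n].
Qed.

Lemma Zquo_ker x : (Zquo n m x == 1%g) = (x \in Zsub n (n %/ m)).
Proof.
have d : n %/ m %| n by rewrite -{2}(divnK mn) dvdn_mulr.
by rewrite mem_Zsub // divnA // mulKn // FinRing.zmod1gE Zquo_eq0.
Qed.

End ModularArithmetic.

Lemma Zemb_trans k m n (x : 'Z_k) : 1 < k -> 0 < n -> k %| m -> m %| n ->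
  Zemb m n (Zemb k m x) = Zemb k n x.
Proof.
move=> k1 n0 km mn; have m0 := dvdn_gt0 n0 mn.
have m1 : 1 < m := leq_trans k1 (dvdn_leq m0 km).
rewrite -(natr_Zp x) !Zemb_nat //; last exact: dvdn_trans mn.
by rewrite -mulnA; congr (_ * _)%:R%R; rewrite mulnC muln_divA // divnK.
Qed.

Lemma Zquo_trans n m k (x : 'Z_n) : 1 < k -> 0 < n -> k %| m -> m %| n ->
  Zquo m k (Zquo n m x) = Zquo n k x.
Proof.
move=> k1 n0 km mn; have m0 := dvdn_gt0 n0 mn.
have m1 : 1 < m := leq_trans k1 (dvdn_leq m0 km).
by rewrite -(natr_Zp x) !Zquo_nat // (dvdn_trans km).
Qed.

(** Both composites multiply a representative by the same integer, as the last hypothesis says. This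
    is the commutative square of the section [U / L]. *)
Lemma Zquo_Zemb n n1 n2 m (x : 'Z_n1) : 1 < m -> 0 < n -> n1 %| n -> n2 %| n ->
  m %| n1 -> m %| n2 -> n %/ n1 = n2 %/ m ->
  Zquo n n2 (Zemb n1 n x) = Zemb m n2 (Zquo n1 m x).
Proof.
move=> m1 n0 n1n n2n mn1 mn2 e.
have n1_gt0 := dvdn_gt0 n0 n1n; have n2_gt0 := dvdn_gt0 n0 n2n.
have n1_gt1 := leq_trans m1 (dvdn_leq n1_gt0 mn1).
have n2_gt1 := leq_trans m1 (dvdn_leq n2_gt0 mn2).
by rewrite -(natr_Zp x) Zemb_nat // !Zquo_nat // Zemb_nat // e.
Qed.

Lemma eq_imset_sep (aT rT : finType) (f : aT -> rT) (S : {set aT}) (P Q : pred aT) :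
  P =1 Q -> [set f x | x in S & P x] = [set f x | x in S & Q x].
Proof.
move=> PQ; apply/setP=> y.
by apply/imsetP/imsetP=> -[x]; rewrite inE ?PQ -?PQ => SP ->; exists x; rewrite // inE ?PQ -?PQ.
Qed.

(** * Generalized wreath products over cyclic groups *)

Section CyclicWreath.
Variables n1 n2 m n : nat.
Variables (B1 : {set {set 'Z_n1}}) (B2 : {set {set 'Z_n2}}).
Hypotheses (m_gt1 : 1 < m) (n1_gt0 : 0 < n1) (n2_gt0 : 0 < n2).

Definition Zwreath : {set {set 'Z_n}} :=
  wreath_classes (Zemb n1 n) (Zquo n n2) (Zemb m n2) B1 B2.

Hypothesis compat : gwreath_compat n1 n2 m B1 B2.
Hypothesis n_def : n = n1 * n2 %/ m.

Let mn1 : m %| n1. Proof. by case: compat => _ []. Qed.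
Let mn2 : m %| n2. Proof. by case: compat => _ []. Qed.
Let n_def1 : n = n1 * (n2 %/ m). Proof. by rewrite n_def muln_divA. Qed.
Let n_def2 : n = n1 %/ m * n2. Proof. by rewrite n_def divn_mulAC. Qed.
Let n1n : n1 %| n. Proof. by rewrite n_def1 dvdn_mulr. Qed.
Let n2n : n2 %| n. Proof. by rewrite n_def2 dvdn_mull. Qed.
Let n1_gt1 : 1 < n1. Proof. exact: leq_trans m_gt1 (dvdn_leq n1_gt0 mn1). Qed.
Let n2_gt1 : 1 < n2. Proof. exact: leq_trans m_gt1 (dvdn_leq n2_gt0 mn2). Qed.
Let n_gt0 : 0 < n.
Proof. by rewrite n_def1 muln_gt0 n1_gt0 (divn_gt0 _ (ltnW m_gt1)) (dvdn_leq n2_gt0 mn2). Qed.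
Let n_n1 : n %/ n1 = n2 %/ m. Proof. by rewrite n_def1 mulKn. Qed.
Let n_n2 : n %/ n2 = n1 %/ m. Proof. by rewrite n_def2 mulnK. Qed.

Let B1_sring : is_sring B1. Proof. by case: compat => [[]]. Qed.
Let B2_sring : is_sring B2. Proof. by case: compat => [[]]. Qed.
Let pB1 : partition B1 setT. Proof. by case: B1_sring. Qed.
Let pB2 : partition B2 setT. Proof. by case: B2_sring. Qed.

Let square x : Zquo n n2 (Zemb n1 n x) = Zemb m n2 (Zquo n1 m x).
Proof. exact: Zquo_Zemb. Qed.

Let cartesian x : Zquo n n2 x \in codom (Zemb m n2) -> x \in codom (Zemb n1 n).
Proof.
have dvd : n2 %/ m %| n2 by rewrite -{2}(divnK mn2) dvdn_mulr.
rewrite -(natr_Zp x) (Zquo_nat n2_gt1 n_gt0 n2n) (codom_Zemb m_gt1 n2_gt0 mn2).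
by rewrite (codom_Zemb n1_gt1 n_gt0 n1n) natr_Zp n_n1 dvd_natr.
Qed.

Let ker_B1 X x y : X \in B1 -> x \in X -> y \in X ->
  Zquo n1 m x = 1%g -> Zquo n1 m y = 1%g.
Proof.
move=> XB xX yX /eqP; rewrite (Zquo_ker m_gt1 n1_gt0 mn1) => xL.
apply/eqP; rewrite (Zquo_ker m_gt1 n1_gt0 mn1).
have /(sring_subgroupP _ pB1) cl : sring_subgroup B1 (Zsub n1 (n1 %/ m)).
  by case: compat.
exact: cl XB xX yX xL.
Qed.

Let im_B2 Y x y : Y \in B2 -> x \in Y -> y \in Y ->
  x \in codom (Zemb m n2) -> y \in codom (Zemb m n2).
Proof.
rewrite !codom_Zemb_Zsub // => YB xY yY.
have /(sring_subgroupP _ pB2) cl : sring_subgroup B2 (Zsub n2 m) by case: compat.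
exact: cl YB xY yY.
Qed.

Let quo_restr : [set Zquo n1 m @: X | X : {set 'Z_n1} in B1] =
  [set Zemb m n2 @^-1: Y | Y : {set 'Z_n2} in B2 & Y \subset codom (Zemb m n2)].
Proof.
case: compat => _ _ _ _; rewrite /sring_quo /sring_restr => ->.
apply: eq_imset_sep => Y.
by apply: eq_subset_r => x; rewrite codom_Zemb_Zsub.
Qed.

Let iotaM := Zemb_add n1_gt1 n_gt0 n1n.
Let piM := Zquo_add n2_gt1 n_gt0 n2n.
Let jM := Zemb_add m_gt1 n2_gt0 mn2.
Let pi'M := Zquo_add m_gt1 n1_gt0 mn1.
Let iota_inj := Zemb_inj n1_gt1 n_gt0 n1n.
Let j_inj := Zemb_inj m_gt1 n2_gt0 mn2.
Let sectK := Zquo_sectK n2_gt1 n_gt0 n2n.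

Lemma Zwreath_sring : is_sring Zwreath.
Proof.
exact: (wreath_sring iotaM piM pi'M jM iota_inj j_inj sectK square cartesian
  (@Zmod_mulgC n) B1_sring B2_sring ker_B1 im_B2 quo_restr).
Qed.

Let saturatedP (X : {set 'Z_n}) :
  (X = \bigcup_(x in X) (x *: Zsub n (n1 %/ m))%g) <->
  (forall x y, x \in X -> Zquo n n2 x = Zquo n n2 y -> y \in X).
Proof.
(* The subgroup [L] is the kernel of the quotient map, so its cosets are the fibres. *)
have coset x y : (y \in (x *: Zsub n (n1 %/ m))%g) = (Zquo n n2 x == Zquo n n2 y).
  rewrite mem_lcoset -n_n2 -(Zquo_ker n2_gt1 n_gt0 n2n).
  by rewrite piM (morph_V piM) -eq_mulVg1.
split=> [-> x y /bigcupP[z zX]|sat].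
  by rewrite coset => /eqP zx xy; apply/bigcupP; exists z; rewrite // coset zx xy.
apply/setP=> y; apply/idP/bigcupP => [yX|[x xX]]; first by exists y; rewrite ?coset.
by rewrite coset => /eqP; apply: sat.
Qed.

Lemma Zwreath_unique : unique (is_gwreath n1 n2 m n B1 B2) Zwreath.
Proof.
have inU := codom_Zemb_Zsub n1_gt1 n_gt0 n1n.
have restrE (B : {set {set 'Z_n}}) :
    [set Zemb n1 n @^-1: X | X : {set 'Z_n} in B & X \subset codom (Zemb n1 n)]
    = sring_restr n n1 B.
  by apply: eq_imset_sep => X; apply: eq_subset_r.
have inL x : (x \in Zsub n (n1 %/ m)) = (Zquo n n2 x == 1%g).
  by rewrite -n_n2 Zquo_ker.
have pW : partition Zwreath setT by case: Zwreath_sring.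
split.
  split=> //.
  - exact: Zwreath_sring.
  - split; apply/(sring_subgroupP _ pW) => X x y XW xX yX.
      by rewrite -!inU; apply: (wreath_im square cartesian im_B2 XW xX yX).
    by rewrite !inL => /eqP x1; apply/eqP; move: x1;
       apply: (wreath_ker jM j_inj square ker_B1 im_B2 XW xX yX).
  - split; first by rewrite -restrE;
      exact: (wreath_restr iota_inj sectK square cartesian B1 B2_sring im_B2).
    exact: (wreath_quo sectK square im_B2 quo_restr).
  - move=> X XW /subsetP XU; apply/saturatedP => x y xX.
    by apply: (wreath_saturated im_B2 XW xX); rewrite inU; have := XU _ xX; rewrite inE.
move=> B [_ [pB _ _ _] [/(sring_subgroupP _ pB) BU _] [restrB quoB] satB].
apply/esym/(wreath_unique (sect := Zquo n2 n)) => //.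
- by move=> X x y XB xX yX; rewrite !inU; apply: BU XB xX yX.
- by rewrite restrE.
- move=> X x y XB xX nx.
  have /saturatedP sat: X = \bigcup_(x in X) (x *: Zsub n (n1 %/ m))%g.
    apply: satB => //; apply/subsetP=> z zX; rewrite inE; apply: contra nx.
    by rewrite inU; apply: BU XB zX xX.
  exact: sat.
Qed.

End CyclicWreath.

(** * Cyclotomic S-rings *)

Section Cyclotomic.
Variables (n : nat) (K : {group {perm 'Z_n}}).
Hypothesis K_Aut : K \subset Aut [set: 'Z_n].

(** An additive map is determined by the image of the generator 1. From here on an automorphism [s]
    is handled through its multiplier [s 1]. *)
Lemma Aut_mul s (x : 'Z_n) : s \in Aut [set: 'Z_n] -> s x = (s 1 * x)%R.
Proof.
move=> sA; have sX k : s (k%:R)%R = (s 1 *+ k)%R.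
  have := morphX (autm_morphism sA) k (in_setT (1%R : 'Z_n)).
  by rewrite /= !autmE.
by rewrite -{1}(natr_Zp x) sX -mulr_natr natr_Zp.
Qed.

Lemma Aut_compE s t : s \in K -> t \in K -> (s * t)%g 1%R = (s 1 * t 1)%R.
Proof. by move=> _ /(subsetP K_Aut) tA; rewrite permM (Aut_mul _ tA) mulrC. Qed.

Lemma Aut_expE s k : s \in K -> (s ^+ k)%g 1%R = (s 1 ^+ k)%R.
Proof.
move=> sK; elim: k => [|k IH]; first by rewrite expg0 perm1.
by rewrite expgS Aut_compE ?groupX // IH exprS.
Qed.

Lemma mem_CycP (x y : 'Z_n) :
  reflect (exists2 s, s \in K & y = s 1%R * x)%R (y \in orbit 'P K x).
Proof.
apply: (iffP orbitP) => -[s sK].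
  by move=> <-; exists s => //; rewrite /= apermE (Aut_mul _ (subsetP K_Aut _ sK)).
by move=> ->; exists s => //; rewrite /= apermE (Aut_mul _ (subsetP K_Aut _ sK)).
Qed.

Lemma Cyc_partition : partition (Cyc n K) setT.
Proof.
have -> : Cyc n K = orbit 'P K @: [set: 'Z_n].
  by apply/setP=> X; apply/imsetP/imsetP=> -[x _ ->]; exists x.
by apply: orbit_partition; apply/subsetP=> s _; apply/astabsP=> x; rewrite !inE.
Qed.

Lemma orbit_Cyc x : orbit 'P K x \in Cyc n K.
Proof. exact: imset_f. Qed.

Lemma class_const_Cyc (f : zgring 'Z_n) : class_const (Cyc n K) f <->
  (forall s x, s \in K -> f (s x) = f x).
Proof.
split=> [cf s x sK|inv X x y /imsetP[z _ ->] /orbitP[s sK <-] /orbitP[t tK <-]].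
  by apply: cf (orbit_Cyc x) _ (orbit_refl _ _ _); apply/orbitP; exists s.
by rewrite /= !apermE !inv.
Qed.

(** Group automorphisms act on the group ring by ring automorphisms, and the functions constant on
    orbits are the fixed points of this action, hence closed under convolution. *)
Lemma Cyc_sring : is_sring (Cyc n K).
Proof.
have sM s : s \in K -> {morph s : x y / (x * y)%g}.
  move=> /(subsetP K_Aut) sA x y.
  rewrite (Aut_mul x sA) (Aut_mul y sA) (Aut_mul (x * y)%g sA).
  by rewrite !FinRing.zmodMgE mulrDr.
apply: is_sring_intro Cyc_partition _ _ _.
- have -> : [set 1%g] = orbit 'P K (1%g : 'Z_n); last exact: orbit_Cyc.
  apply/setP=> x; rewrite inE; apply/eqP/mem_CycP => [->|[s _ ->]].
    by exists 1%g; rewrite ?group1 // FinRing.zmod1gE mulr0.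
  by rewrite FinRing.zmod1gE mulr0.
- move=> X /imsetP[x _ ->].
  suff -> : ((orbit 'P K x)^-1)%g = orbit 'P K (x^-1)%g by apply: orbit_Cyc.
  apply/setP=> y; rewrite inE.
  apply/mem_CycP/mem_CycP => -[s sK e]; exists s => //.
    by rewrite -[y]invgK e !FinRing.zmodVgE mulrN.
  by rewrite e !FinRing.zmodVgE mulrN opprK.
- move=> f h /class_const_Cyc cf /class_const_Cyc ch; apply/class_const_Cyc => s x sK.
  rewrite !ffunE (reindex_inj (@perm_inj _ s)); apply: eq_bigr => y _ /=.
  by rewrite -(morph_V (sM s sK)) -(sM s sK) cf // ch.
Qed.

Lemma Zsub_mul k (a x : 'Z_n) : x \in Zsub n k -> (a * x)%R \in Zsub n k.
Proof.
move=> xH; rewrite -(natr_Zp a) mulrC mulr_natr -FinRing.zmodXgE.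
exact: groupX.
Qed.

Lemma sring_subgroup_Cyc k : sring_subgroup (Cyc n K) (Zsub n k).
Proof.
apply/(sring_subgroupP _ Cyc_partition) => X x y /imsetP[z _ ->].
move=> /orbit_eqP/esym xz + xH; rewrite xz => /mem_CycP[s _ ->].
exact: Zsub_mul.
Qed.

(** The multipliers of [K] modulo [m]. Restriction to the subgroup of order [m] and passage to the
    quotient of order [m] both give the classes [mul_orbit (residues m) x], so compatibility of
    cyclotomic S-rings becomes an equality of sets of residues. *)
Definition residues m : {set 'Z_m} := [set Zquo n m (s 1%R) | s : {perm 'Z_n} in K].
Definition mul_orbit m (R : {set 'Z_m}) (x : 'Z_m) : {set 'Z_m} :=
  [set (r * x)%R | r in R].

Lemma mem_residues m s : s \in K -> Zquo n m (s 1%R) \in residues m.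
Proof. exact: (imset_f (fun t : {perm 'Z_n} => Zquo n m (t 1%R))). Qed.

Variable m : nat.
Hypotheses (m_gt1 : 1 < m) (n_gt0 : 0 < n) (mn : m %| n).

Let n_gt1 : 1 < n. Proof. exact: leq_trans m_gt1 (dvdn_leq n_gt0 mn). Qed.

Lemma Zemb_scale (a : 'Z_n) (z : 'Z_m) :
  (a * Zemb m n z)%R = Zemb m n (Zquo n m a * z)%R.
Proof.
rewrite -(natr_Zp a) -(natr_Zp z) Zquo_nat // -natrM !Zemb_nat // -natrM.
by rewrite mulnA.
Qed.

Lemma Zemb_orbit z : Zemb m n @^-1: orbit 'P K (Zemb m n z) = mul_orbit (residues m) z.
Proof.
apply/setP=> w; rewrite inE; apply/mem_CycP/imsetP => [[s sK]|[r /imsetP[s sK ->] ->]].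
  rewrite Zemb_scale => /(Zemb_inj m_gt1 n_gt0 mn) ->.
  by exists (Zquo n m (s 1%R)) => //; apply: mem_residues.
by exists s; rewrite // Zemb_scale.
Qed.

Lemma Zquo_orbit x : Zquo n m @: orbit 'P K x = mul_orbit (residues m) (Zquo n m x).
Proof.
apply/setP=> w; apply/imsetP/imsetP => [[y /mem_CycP[s sK ->] ->]|[r /imsetP[s sK ->] ->]].
  by exists (Zquo n m (s 1%R)); rewrite ?mem_residues ?Zquo_mul.
by exists (s 1 * x)%R; rewrite ?Zquo_mul //; apply/mem_CycP; exists s.
Qed.

Lemma sring_quo_Cyc :
  sring_quo n m (Cyc n K) = [set mul_orbit (residues m) x | x : 'Z_m].
Proof.
apply/setP=> Y; apply/imsetP/imsetP => [[X /imsetP[x _ ->] ->]|[x _ ->]].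
  by exists (Zquo n m x); rewrite ?Zquo_orbit.
exists (orbit 'P K (Zquo m n x)); first exact: orbit_Cyc.
by rewrite Zquo_orbit Zquo_sectK.
Qed.

Lemma sring_restr_Cyc :
  sring_restr n m (Cyc n K) = [set mul_orbit (residues m) x | x : 'Z_m].
Proof.
have sub x : (orbit 'P K x \subset Zsub n m) = (x \in codom (Zemb m n)).
  rewrite codom_Zemb_Zsub //.
  apply: (sring_subgroup_sub Cyc_partition (sring_subgroup_Cyc m) (orbit_Cyc x)).
  exact: orbit_refl.
apply/setP=> Y; apply/imsetP/imsetP => [[X]|[x _ ->]].
  rewrite inE => /andP[/imsetP[x _ ->]]; rewrite sub => /codomP[z ->] ->.
  by exists z; rewrite ?Zemb_orbit.
exists (orbit 'P K (Zemb m n x)); last by rewrite Zemb_orbit.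
by rewrite inE orbit_Cyc sub codom_f.
Qed.

Lemma card_Zsub : #|Zsub n m| = m.
Proof.
rewrite -(eq_card (codom_Zemb_Zsub m_gt1 n_gt0 mn)) card_codom ?card_ord ?Zp_cast //.
exact: Zemb_inj.
Qed.

(** A cyclic group has at most one subgroup of each order. *)
Lemma pcore_Zp (q : nat) : n`_q = m -> 'O_q([set: 'Z_n])%g = Zsub n m.
Proof.
move=> nq; apply/eqP; rewrite (@eq_subG_cyclic _ [set: 'Z_n]%G) ?subsetT //.
  rewrite (card_Hall (nilpotent_pcore_Hall _ _)); last exact/abelian_nil/Zp_abelian.
  by rewrite card_Zsub cardsT card_ord Zp_cast // nq.
by apply/cyclicP; exists Zp1; apply: Zp_cycle.
Qed.

(** Lagrange's theorem for restriction to the Sylow subgroup: the kernel [N] consists of the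
    automorphisms whose multiplier is 1 modulo [m]. *)
Lemma Aut_proj_card (q : nat) : n`_q = m -> exists2 N : {group {perm 'Z_n}},
  N =i [set s in K | Zquo n m (s 1%R) == 1%R] & #|Aut_proj n q K| * #|N| = #|K|.
Proof.
move=> nq; set S := 'O_q([set: 'Z_n])%g.
have SE : S = Zsub n m by exact: pcore_Zp.
have sZ s x : s \in K -> (s x \in Zsub n m) = (x \in Zsub n m).
  move=> sK; have sVK : (s^-1)%g \in K by rewrite groupV.
  apply/idP/idP => [|xS].
    move/(Zsub_mul ((s^-1)%g 1%R)).
    by rewrite -(Aut_mul _ (subsetP K_Aut _ sVK)) permK.
  by rewrite (Aut_mul _ (subsetP K_Aut _ sK)) Zsub_mul.
(* [restr_perm] is a morphism on the stabilizer of [S] only, so [K] has to lie in that domain. *)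
have KD : K \subset 'N(S | 'P)%g.
  by apply/subsetP=> s sK; apply/astabsP=> x; rewrite SE /= apermE sZ.
exists (K :&: 'ker (restr_perm S))%G.
  move=> s; rewrite [LHS]inE [RHS]inE /= ker_restr_perm.
  case sK: (s \in K) => //=; have sA := subsetP K_Aut _ sK.
  apply/astabP/eqP => [fixS|s1 x].
    have := fixS (Zemb m n 1%R); rewrite SE -codom_Zemb_Zsub // codom_f /= apermE.
    rewrite (Aut_mul _ sA) Zemb_scale mulr1.
    by move/(_ isT)/(Zemb_inj m_gt1 n_gt0 mn).
  rewrite SE -codom_Zemb_Zsub // => /codomP[z ->].
  by rewrite /= apermE (Aut_mul _ sA) Zemb_scale s1 mul1r.
rewrite /Aut_proj card_morphim (setIidPr KD) -indexgI mulnC.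
by rewrite Lagrange ?subsetIl.
Qed.

Lemma Zquo_div s t : s \in K -> t \in K -> Zquo n m (s 1%R) = Zquo n m (t 1%R) ->
  Zquo n m ((s * t^-1)%g 1%R) = 1%R.
Proof.
move=> sK tK e; have tVK : (t^-1)%g \in K by rewrite groupV.
rewrite Aut_compE // Zquo_mul // e -Zquo_mul // -Aut_compE // mulgV perm1.
by rewrite (Zquo_nat m_gt1 n_gt0 mn 1).
Qed.

(** Equal orders force the kernel from [Aut_proj_card] to be trivial. *)
Lemma residues_inj (q : nat) : n`_q = m -> #|Aut_proj n q K| = #|K| ->
  {in K &, injective (fun s : {perm 'Z_n} => Zquo n m (s 1%R))}.
Proof.
move=> nq Kq; have [N eN cN] := Aut_proj_card nq.
have triv s : s \in K -> Zquo n m (s 1%R) = 1%R -> s = 1%g.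
  move=> sK s1; have /eqP: #|N| = 1.
    by apply/eqP; rewrite -(eqn_pmul2l (cardG_gt0 K)) -{1}Kq cN muln1.
  rewrite -trivg_card1 => /eqP N1.
  by have := eN s; rewrite N1 !inE sK s1 eqxx => /eqP.
move=> s t sK tK /= e; apply/eqP; rewrite eq_mulgV1; apply/eqP/triv.
  by rewrite groupM ?groupV.
exact: Zquo_div.
Qed.

Lemma Zquo_exp (c : 'Z_n) k : Zquo n m (c ^+ k)%R = (Zquo n m c ^+ k)%R.
Proof.
elim: k => [|k IH]; first by rewrite (Zquo_nat m_gt1 n_gt0 mn 1).
by rewrite !exprS Zquo_mul // IH.
Qed.

Lemma residues_card (c : 'Z_m) : c \in residues m -> (c ^+ #|K| = 1)%R.
Proof.
case/imsetP=> s sK ->; rewrite -Zquo_exp -Aut_expE // expg_cardG // perm1.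
exact: (Zquo_nat m_gt1 n_gt0 mn 1).
Qed.

End Cyclotomic.

(** * Residues of multipliers and roots of unity *)

Section Roots.

Definition unity_roots q d : {set 'Z_q} := [set c : 'Z_q | c ^+ d == 1]%R.

Lemma card_unity_roots q d : prime q -> 0 < d -> #|unity_roots q d| <= d.
Proof.
(* The field ['F_q] is built on [pdiv q]; writing [q] in this form gives access to the bound on
   roots of unity in a field. *)
move=> q_pr d_gt0; rewrite -(pdiv_id q_pr) cardE.
apply: (@max_unity_roots 'F_q) => //; last exact: enum_uniq.
by apply/allP=> c; rewrite mem_enum inE unity_rootE.
Qed.

Lemma Zp_fermat q (c : 'Z_q) : prime q -> (c ^+ q = c)%R.
Proof.
move=> q_pr; rewrite -(natr_Zp c) -natrX; apply/(natr_eqP _ _ (prime_gt1 q_pr)).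
exact: fermat_little.
Qed.

Section PrimeResidues.
Variables (n q d : nat) (K : {group {perm 'Z_n}}).
Hypotheses (K_Aut : K \subset Aut [set: 'Z_n]) (q_pr : prime q) (n_gt0 : 0 < n).
Hypotheses (d_gt0 : 0 < d).

(** The [d] elements of [K] have distinct residues, all of them [d]-th roots of unity, and there are
    at most [d] such roots. So the residues depend on [d] and [q] alone. *)
Lemma prime_residues : n`_q = q -> #|K| = d -> #|Aut_proj n q K| = d ->
  residues K q = unity_roots q d.
Proof.
move=> nq K_card K_q; have q_gt1 := prime_gt1 q_pr.
have qn : q %| n by rewrite -{1}nq dvdn_part.
apply/eqP; rewrite eqEcard; apply/andP; split.
  apply/subsetP=> c cK; rewrite inE -K_card.
  by rewrite (residues_card K_Aut q_gt1 n_gt0 qn).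
rewrite card_in_imset; first by rewrite K_card card_unity_roots.
by apply: (residues_inj K_Aut q_gt1 n_gt0 qn nq); rewrite K_card.
Qed.

(** A residue satisfies [c ^ (q * d) = 1], which modulo [q] becomes [c ^ d = 1] by Fermat. The right
    side has at most [q * d] elements, and the left side has exactly that many. *)
Lemma square_residues : n`_q = q ^ 2 -> #|K| = q * d -> #|Aut_proj n q K| = q * d ->
  residues K (q ^ 2) = [set c | Zquo (q ^ 2) q c \in unity_roots q d].
Proof.
move=> nq K_card K_q; have q_gt1 := prime_gt1 q_pr.
have q_gt0 := ltnW q_gt1; have qq : q %| q ^ 2 by rewrite expnS dvdn_mulr.
have q2_gt0 : 0 < q ^ 2 by rewrite expn_gt0 q_gt0.
have q2_gt1 : 1 < q ^ 2 := leq_trans q_gt1 (dvdn_leq q2_gt0 qq).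
have qn : q ^ 2 %| n by rewrite -nq dvdn_part.
apply/eqP; rewrite eqEcard; apply/andP; split.
  apply/subsetP=> c cK; rewrite !inE.
  have := residues_card K_Aut q2_gt1 n_gt0 qn cK.
  move/(congr1 (Zquo (q ^ 2) q)); rewrite Zquo_exp // (Zquo_nat q_gt1 q2_gt0 qq 1).
  by rewrite K_card exprM Zp_fermat // => /eqP.
rewrite card_in_imset; last first.
  by apply: (residues_inj K_Aut q2_gt1 n_gt0 qn nq); rewrite K_card.
(* The two base [q] digits of [c]; the low digit has at most [d] values and the high digit at most
   [q]. *)
pose f (c : 'Z_(q ^ 2)) : 'Z_q * 'Z_q := (Zquo (q ^ 2) q c, (c %/ q)%:R%R).
have f_inj : injective f.
  move=> x y; have lt (z : 'Z_(q ^ 2)) : z %/ q < q.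
    by rewrite ltn_divLR // (leq_trans (val_Zp_lt z q2_gt1)) // expnS expn1.
  move=> /pair_equal_spec[]; rewrite /Zquo -!Zp_nat.
  move=> /(natr_eqP _ _ q_gt1) exy /(natr_eqP _ _ q_gt1).
  rewrite !modn_small // => dxy; apply: val_inj => /=.
  by rewrite (divn_eq x q) (divn_eq y q) dxy exy.
rewrite K_card -(card_imset _ f_inj).
apply: (@leq_trans #|setX (unity_roots q d) [set: 'Z_q]|).
  apply/subset_leq_card/subsetP=> _ /imsetP[c + ->].
  by rewrite inE => cR; rewrite in_setX cR in_setT.
have card_Zq : #|'Z_q| = q by rewrite card_ord Zp_cast.
by rewrite cardsX cardsT card_Zq mulnC leq_mul2l card_unity_roots // orbT.
Qed.

(** Let [c] be the residue of [s * t^-1] modulo [q ^ 2]. The kernel of the projection to the Sylow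
    [r]-subgroup has order [d], so [c ^ d = 1]; and [c] is 1 modulo [q], so [c ^ q = 1]. As [d]
    divides [q - 1], this leaves [c = 1], and [residues_inj] applies. *)
Lemma square_residues_inj r : r %| n -> 1 < r -> n`_q = q ^ 2 -> n`_r = r ->
  d %| q - 1 -> #|K| = q * d -> #|Aut_proj n q K| = q * d ->
  #|Aut_proj n r K| = q ->
  {in K &, forall s t : {perm 'Z_n}, Zquo n q (s 1%R) = Zquo n q (t 1%R) ->
                       Zquo n r (s 1%R) = Zquo n r (t 1%R) -> s = t}.
Proof.
move=> rn r_gt1 nq nr dq K_card K_q K_r s t sK tK eq er.
have q_gt1 := prime_gt1 q_pr; have q_gt0 := ltnW q_gt1.
have qq : q %| q ^ 2 by rewrite expnS dvdn_mulr.
have q2_gt0 : 0 < q ^ 2 by rewrite expn_gt0 q_gt0.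
have q2_gt1 : 1 < q ^ 2 := leq_trans q_gt1 (dvdn_leq q2_gt0 qq).
have qn : q ^ 2 %| n by rewrite -nq dvdn_part.
set u := (s * t^-1)%g; have uK : u \in K by rewrite groupM ?groupV.
have u_q : Zquo n q (u 1%R) = 1%R by exact: (Zquo_div K_Aut q_gt1 n_gt0 (dvdn_trans qq qn)).
have u_r : Zquo n r (u 1%R) = 1%R by exact: (Zquo_div K_Aut r_gt1 n_gt0 rn).
suff u1 : Zquo n (q ^ 2) (u 1%R) = 1%R.
  apply/eqP; rewrite eq_mulgV1; apply/eqP.
  apply: (residues_inj K_Aut q2_gt1 n_gt0 qn nq _ uK (group1 K)); first by rewrite K_card.
  by rewrite /= u1 perm1 (Zquo_nat q2_gt1 n_gt0 qn 1).
set c := Zquo n (q ^ 2) (u 1%R).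
have cd : (c ^+ d = 1)%R.
  have [N eN cN] := Aut_proj_card K_Aut r_gt1 n_gt0 rn nr.
  have N_card : #|N| = d by apply/eqP; rewrite -(eqn_pmul2l q_gt0) -K_card -{1}K_r cN.
  have uN : u \in N by rewrite eN inE uK u_r eqxx.
  rewrite -Zquo_exp // -(Aut_expE K_Aut) // -N_card expg_cardG // perm1.
  exact: (Zquo_nat q2_gt1 n_gt0 qn 1).
have cq : (c ^+ q = 1)%R.
  have c1 : Zquo (q ^ 2) q c = 1%R by rewrite /c Zquo_trans.
  have mulq (x : 'Z_(q ^ 2)) : Zquo (q ^ 2) q x = 0%R -> exists k, x = (q * k)%:R%R.
    move/eqP; rewrite Zquo_eq0 // => /dvdnP[k xk]; exists k.
    by rewrite mulnC -xk natr_Zp.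
  have Zsum (x y : 'Z_(q ^ 2)) : Zquo (q ^ 2) q (x + y)%R =
      (Zquo (q ^ 2) q x + Zquo (q ^ 2) q y)%R by apply: (Zquo_add q_gt1 q2_gt0 qq).
  have Z1 : Zquo (q ^ 2) q 1%R = 1%R by apply: (Zquo_nat q_gt1 q2_gt0 qq 1).
  (* Both factors of [c ^ q - 1], namely [c - 1] and the sum of the [q] powers of [c], are divisible
     by [q], so the product vanishes modulo [q ^ 2]. *)
  apply/eqP; rewrite -subr_eq0 subrX1; apply/eqP.
  have [k ->] : exists k, (c - 1 = (q * k)%:R)%R.
    by apply: mulq; rewrite Zsum c1 -Z1 -Zsum subrr (Zquo_nat q_gt1 q2_gt0 qq 0).
  have [l ->] : exists l, (\sum_(i < q) c ^+ i = (q * l)%:R)%R.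
    apply: mulq; rewrite (big_morph _ Zsum (Zquo_nat q_gt1 q2_gt0 qq 0)).
    rewrite (eq_bigr (fun=> 1%R)) => [|i _]; last by rewrite Zquo_exp // c1 expr1n.
    by rewrite sumr_const card_ord pchar_Zp.
  rewrite -natrM; apply/(natr_eqP _ 0 q2_gt1)/eqP.
  by rewrite mod0n -/(dvdn _ _) mulnACA mulnn dvdn_mulr.
have cq1 : (c ^+ (q - 1) = 1)%R by case/dvdnP: dq => e ->; rewrite mulnC exprM cd expr1n.
have ce : (c ^+ (q - 1) * c = c ^+ q)%R.
  by rewrite -exprSr; congr (c ^+ _)%R; rewrite subn1 prednK.
by rewrite -[LHS]mul1r -cq1 ce cq.
Qed.

End PrimeResidues.

End Roots.

(** * The wreath product of two cyclotomic S-rings and its restriction to the Sylow [p]-subgroup *)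

Section CyclotomicWreath.
Variables (p q : nat) (M1 M2 : {group {perm 'Z_(p * q)}}).
Hypotheses (p_pr : prime p) (q_pr : prime q) (p_neq_q : p != q).
Hypotheses (M1_Aut : M1 \subset Aut [set: 'Z_(p * q)]).
Hypotheses (M2_Aut : M2 \subset Aut [set: 'Z_(p * q)]).
Hypothesis residues_q : residues M1 q = residues M2 q.

Let p_gt1 : 1 < p. Proof. exact: prime_gt1. Qed.
Let q_gt1 : 1 < q. Proof. exact: prime_gt1. Qed.
Let p_gt0 : 0 < p. Proof. exact: ltnW. Qed.
Let q_gt0 : 0 < q. Proof. exact: ltnW. Qed.
Let pq_gt0 : 0 < p * q. Proof. by rewrite muln_gt0 p_gt0. Qed.
Let p_pq : p %| p * q. Proof. exact: dvdn_mulr. Qed.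
Let q_pq : q %| p * q. Proof. exact: dvdn_mull. Qed.
Let pq_gt1 : 1 < p * q. Proof. exact: leq_trans p_gt1 (dvdn_leq pq_gt0 p_pq). Qed.
Let p2_gt0 : 0 < p ^ 2. Proof. by rewrite expn_gt0 p_gt0. Qed.
Let p_p2 : p %| p ^ 2. Proof. by rewrite expnS dvdn_mulr. Qed.
Let p2_gt1 : 1 < p ^ 2. Proof. exact: leq_trans p_gt1 (dvdn_leq p2_gt0 p_p2). Qed.
Let n_gt0 : 0 < p ^ 2 * q. Proof. by rewrite muln_gt0 p2_gt0. Qed.
Let n_def : p ^ 2 * q = p * (p * q). Proof. by rewrite expnS expn1 mulnA. Qed.
Let pq_n : p * q %| p ^ 2 * q. Proof. by rewrite n_def dvdn_mull. Qed.
Let p2_n : p ^ 2 %| p ^ 2 * q. Proof. exact: dvdn_mulr. Qed.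
Let q_n : q %| p ^ 2 * q. Proof. exact: dvdn_mull. Qed.
Let n_gt1 : 1 < p ^ 2 * q. Proof. exact: leq_trans pq_gt1 (dvdn_leq n_gt0 pq_n). Qed.
Let n_p2 : p ^ 2 * q %/ p ^ 2 = q. Proof. exact: mulKn. Qed.
Let p2_p : p ^ 2 %/ p = p. Proof. by rewrite expnS expn1 mulKn. Qed.
Let n_pq : p ^ 2 * q %/ (p * q) = p. Proof. by rewrite n_def mulnK. Qed.
Let pq_p : p * q %/ p = q. Proof. exact: mulKn. Qed.
Let pq_q : p * q %/ q = p. Proof. exact: mulnK. Qed.
Let coqp : coprime q p. Proof. by rewrite prime_coprime // dvdn_prime2 // eq_sym. Qed.

Let A2 : {set {set 'Z_(p ^ 2 * q)}} :=
  Zwreath q (p ^ 2 * q) (Cyc (p * q) M1) (Cyc (p * q) M2).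

Lemma Cyc_compat : gwreath_compat (p * q) (p * q) q (Cyc (p * q) M1) (Cyc (p * q) M2).
Proof.
split; [split; exact: Cyc_sring | by [] | | exact: sring_subgroup_Cyc |].
  exact: sring_subgroup_Cyc.
by rewrite sring_quo_Cyc // sring_restr_Cyc // residues_q.
Qed.

Let wreath_order : p ^ 2 * q = (p * q) * (p * q) %/ q.
Proof. by rewrite n_def mulnAC mulnK. Qed.

Lemma Cyc_wreath_unique :
  unique (is_gwreath (p * q) (p * q) q (p ^ 2 * q) (Cyc (p * q) M1) (Cyc (p * q) M2)) A2.
Proof. exact: Zwreath_unique q_gt1 pq_gt0 pq_gt0 Cyc_compat wreath_order. Qed.

Lemma Cyc_wreath_sring : is_sring A2.
Proof. exact: Zwreath_sring q_gt1 pq_gt0 pq_gt0 Cyc_compat wreath_order. Qed.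

Let A2_partition : partition A2 setT. Proof. by case: Cyc_wreath_sring. Qed.

Let Zsub_emb (u : 'Z_(p * q)) :
  (Zemb (p * q) (p ^ 2 * q) u \in Zsub (p ^ 2 * q) (p ^ 2)) = (u \in Zsub (p * q) p).
Proof.
rewrite !mem_Zsub // n_p2 pq_p -[in LHS](natr_Zp u) Zemb_nat // n_pq.
by rewrite dvd_natr // Gauss_dvdl.
Qed.

Let Zsub_quo (x : 'Z_(p ^ 2 * q)) :
  (Zquo (p ^ 2 * q) (p * q) x \in Zsub (p * q) p) = (x \in Zsub (p ^ 2 * q) (p ^ 2)).
Proof. by rewrite !mem_Zsub // n_p2 pq_p /Zquo -Zp_nat dvd_natr. Qed.

(** Membership means divisibility by [q], which can be tested in the subgroup as well as in the
    quotient of order [p * q]; there the classes respect the subgroup of order [p]. *)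
Lemma Cyc_wreath_subgroup : sring_subgroup A2 (Zsub (p ^ 2 * q) (p ^ 2)).
Proof.
have cl (K : {group {perm 'Z_(p * q)}}) (K_Aut : K \subset Aut [set: 'Z_(p * q)]) y u v :
    u \in orbit 'P K y -> v \in orbit 'P K y -> u \in Zsub (p * q) p -> v \in Zsub (p * q) p.
  have /(sring_subgroupP _ (Cyc_partition K)) := sring_subgroup_Cyc K_Aut p.
  by apply; apply: orbit_Cyc.
apply/(sring_subgroupP _ A2_partition) => X x y.
case/setUP=> /imsetP[Z] => [/imsetP[z _ ->] ->|].
  by case/imsetP=> u uz -> /imsetP[v vz ->]; rewrite !Zsub_emb; apply: cl uz vz.
rewrite inE => /andP[/imsetP[z _ ->] _] ->; rewrite !inE => xz yz.
by rewrite -!Zsub_quo; apply: cl xz yz.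
Qed.

Let Zquo_unit (x : 'Z_(p ^ 2)) : Zquo (p ^ 2) p x != 0%R ->
  (x \is a GRing.unit) && (Zquo (p ^ 2) p x \is a GRing.unit).
Proof.
rewrite Zquo_eq0 // -{2}(natr_Zp x) /Zquo -Zp_nat !unitZpE // => px.
by rewrite coprime_pexpl // andbb prime_coprime.
Qed.

(** Let [W] be the full preimage of [R] in ['Z_(p ^ 2)]. On multiples of [p] it acts through [R],
    giving the classes from [M1]; on units its orbits are full preimages of [R]-orbits modulo [p],
    giving the classes from [M2]. *)
Lemma Cyc_wreath_restr (R : {set 'Z_p}) : residues M1 p = R -> residues M2 p = R ->
  sring_restr (p ^ 2 * q) (p ^ 2) A2 =
    [set mul_orbit [set c | Zquo (p ^ 2) p c \in R] x | x : 'Z_(p ^ 2)].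
Proof.
move=> R1 R2; set W := [set c | _].
have inner (z : 'Z_p) : Zemb (p ^ 2) (p ^ 2 * q) @^-1:
    (Zemb (p * q) (p ^ 2 * q) @: orbit 'P M1 (Zemb p (p * q) z)) =
    mul_orbit W (Zemb p (p ^ 2) z).
  have tr (y : 'Z_p) : Zemb (p * q) (p ^ 2 * q) (Zemb p (p * q) y) =
      Zemb (p ^ 2) (p ^ 2 * q) (Zemb p (p ^ 2) y) by rewrite !Zemb_trans.
  apply/setP=> w; rewrite inE; apply/imsetP/imsetP => [[u /(mem_CycP M1_Aut)[s sM ->]]|].
    rewrite Zemb_scale // tr => /(Zemb_inj p2_gt1 n_gt0 p2_n) ->.
    exists (Zquo p (p ^ 2) (Zquo (p * q) p (s 1%R))).
      by rewrite inE Zquo_sectK // -R1 mem_residues.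
    by rewrite Zemb_scale // Zquo_sectK.
  case=> c; rewrite inE -R1 => /imsetP[s sM cs] ->; rewrite Zemb_scale // -tr cs.
  exists (s 1 * Zemb p (p * q) z)%R; last by rewrite Zemb_scale.
  by apply/(mem_CycP M1_Aut); exists s.
have outer (x : 'Z_(p ^ 2)) : Zquo (p ^ 2) p x != 0%R ->
    Zemb (p ^ 2) (p ^ 2 * q) @^-1: (Zquo (p ^ 2 * q) (p * q) @^-1:
      orbit 'P M2 (Zemb p (p * q) (Zquo (p ^ 2) p x))) = mul_orbit W x.
  move=> /Zquo_unit/andP[xU zU].
  have sq w : Zquo (p ^ 2 * q) (p * q) (Zemb (p ^ 2) (p ^ 2 * q) w) =
      Zemb p (p * q) (Zquo (p ^ 2) p w) by apply: Zquo_Zemb; rewrite ?n_p2 ?pq_p.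
  apply/setP=> w; rewrite !inE sq; apply/(mem_CycP M2_Aut)/imsetP => [[s sM]|].
    rewrite Zemb_scale // => /(Zemb_inj p_gt1 pq_gt0 p_pq) ws.
    (* The required multiplier is a quotient, since [x] is a unit modulo [p ^ 2] when it is nonzero
       modulo [p]. *)
    exists (w / x)%R; last by rewrite divrK.
    rewrite inE -R2; suff -> : Zquo (p ^ 2) p (w / x)%R = Zquo (p * q) p (s 1%R).
      exact: mem_residues.
    by apply: (mulIr zU); rewrite -Zquo_mul // divrK.
  case=> c; rewrite inE -R2 => /imsetP[s sM cs] ->.
  by exists s => //; rewrite Zquo_mul // Zemb_scale // cs.
have sub X x : X \in A2 -> x \in X ->
    (X \subset Zsub (p ^ 2 * q) (p ^ 2)) = (x \in Zsub (p ^ 2 * q) (p ^ 2)).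
  exact: sring_subgroup_sub A2_partition Cyc_wreath_subgroup.
apply/setP=> Y; apply/imsetP/imsetP => [[X]|[x _ ->]].
  rewrite inE => /andP[XA XZ] ->.
  case/setUP: (XA) XZ => /imsetP[Z].
    case/imsetP=> y _ -> eX; rewrite (sub _ (Zemb (p * q) (p ^ 2 * q) y)) //; last first.
      by rewrite eX imset_f ?orbit_refl.
    rewrite Zsub_emb -codom_Zemb_Zsub // => /codomP[z yz].
    by exists (Zemb p (p ^ 2) z); rewrite // eX yz inner.
  rewrite inE => /andP[/imsetP[y _ ->] ny] eX.
  rewrite (sub _ (Zquo (p * q) (p ^ 2 * q) y)) //; last first.
    by rewrite eX inE Zquo_sectK ?orbit_refl.
  rewrite -Zsub_quo Zquo_sectK // -codom_Zemb_Zsub // => /codomP[z yz].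
  exists (Zquo p (p ^ 2) z); rewrite // -outer Zquo_sectK // ?eX ?yz //.
  (* If [z] were zero, the class would be the orbit of 0, which lies in the subgroup of order
     [q]. *)
  apply: contra ny => /eqP z0; apply/subsetP=> u /(mem_CycP M2_Aut)[s _ ->].
  rewrite yz z0 Zemb_scale // mulr0; apply/codomP; exists 0%R.
  by rewrite (Zemb_nat p_gt1 pq_gt0 p_pq 0) (Zemb_nat q_gt1 pq_gt0 q_pq 0).
have [x0|nx] := eqVneq (Zquo (p ^ 2) p x) 0%R.
  have /codomP[z ->] : x \in codom (Zemb p (p ^ 2)).
    by rewrite codom_Zemb // p2_p -Zquo_eq0 // x0.
  exists (Zemb (p * q) (p ^ 2 * q) @: orbit 'P M1 (Zemb p (p * q) z)); last by rewrite inner.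
  have XA : Zemb (p * q) (p ^ 2 * q) @: orbit 'P M1 (Zemb p (p * q) z) \in A2.
    by apply/setUP; left; apply: imset_f; apply: orbit_Cyc.
  rewrite inE XA (sub _ (Zemb (p * q) (p ^ 2 * q) (Zemb p (p * q) z))) //.
    by rewrite Zsub_emb -codom_Zemb_Zsub // codom_f.
  by apply: imset_f; apply: orbit_refl.
exists (Zquo (p ^ 2 * q) (p * q) @^-1: orbit 'P M2 (Zemb p (p * q) (Zquo (p ^ 2) p x))).
  set y := Zemb p (p * q) _.
  have XA : Zquo (p ^ 2 * q) (p * q) @^-1: orbit 'P M2 y \in A2.
    apply/setUP; right; apply: imset_f; rewrite inE orbit_Cyc /=.
    (* Up to reduction, [y] is [q] times [x]; it lies in the subgroup of order [q] only if [p]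
       divides [x]. *)
    apply: contra nx => /subsetP/(_ y (orbit_refl _ _ _)).
    rewrite codom_Zemb // pq_q /y /Zquo -Zp_nat Zemb_nat // pq_p dvd_natr //.
    rewrite Gauss_dvdl 1?coprime_sym // => px.
    by apply/eqP/(natr_eqP _ 0 p_gt1)/eqP; rewrite mod0n.
  rewrite inE XA (sub _ (Zquo (p * q) (p ^ 2 * q) y)) //.
    by rewrite -Zsub_quo Zquo_sectK // -codom_Zemb_Zsub // codom_f.
  by rewrite inE Zquo_sectK // orbit_refl.
by rewrite outer.
Qed.

End CyclotomicWreath.

(** * Schurian S-rings *)

Section Schurian.

Lemma basic_relP (gT : finGroupType) (X : {set gT}) g h :
  ((g, h) \in basic_rel X) = ((h * g^-1)%g \in X).
Proof.
apply/imset2P/idP => [[a x _ xX [-> ->]]|hgX]; first by rewrite mulgK.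
by exists g (h * g^-1)%g; rewrite ?inE ?mulgKV.
Qed.

(** For a partition [S] this one-sided condition is the relation of lying in a common class. *)
Definition same_class (T : finType) (S : {set {set T}}) (a b : T) :=
  forall X : {set T}, X \in S -> a \in X -> b \in X.

(** The pairs [(1, x)] and [(1, y)] lie in one basic relation, that is, in one orbit of [Gamma], so
    some element of [Gamma] carries the first to the second. It preserves every basic relation, each
    being an orbit. *)
Lemma schurian_automorphism (gT : finGroupType) (S : {set {set gT}}) X x y :
  is_sring S -> schurian S -> X \in S -> x \in X -> y \in X ->
  exists s : {perm gT}, [/\ s 1%g = 1%g, s x = y &
    forall g h, same_class S (h * g^-1)%g (s h * (s g)^-1)%g].
Proof.
move=> [pS _ _ _] [Gamma eqS] XS xX yX.
have orb Y : Y \in S -> exists u, basic_rel Y = pair_orbit Gamma u.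
  move=> YS; have: basic_rel Y \in @basic_rel gT @: S by apply: imset_f.
  by rewrite -eqS => /imsetP[u _ ->]; exists u.
have moved Y : Y \in S -> forall s g h, s \in Gamma ->
    (h * g^-1)%g \in Y -> (s h * (s g)^-1)%g \in Y.
  move=> YS s g h sG; rewrite -!basic_relP; have [u ->] := orb Y YS.
  by case/imsetP=> t tG [-> ->]; apply/imsetP; exists (t * s)%g; rewrite ?groupM ?permM.
have [u eX] := orb X XS.
have: (1%g, x) \in basic_rel X by rewrite basic_relP invg1 mulg1.
have: (1%g, y) \in basic_rel X by rewrite basic_relP invg1 mulg1.
rewrite eX => /imsetP[t tG [t1 tx]] /imsetP[r rG [r1 rx]].
exists (r^-1 * t)%g; split.
- by rewrite permM {1}r1 permK -t1.
- by rewrite permM rx permK -tx.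
- by move=> g h Y YS; apply: moved => //; rewrite groupM ?groupV.
Qed.

Lemma same_class_Cyc n (K : {group {perm 'Z_n}}) a b :
  K \subset Aut [set: 'Z_n] -> same_class (Cyc n K) a b ->
  exists2 s, s \in K & b = (s 1 * a)%R.
Proof.
move=> K_Aut /(_ _ (orbit_Cyc K a) (orbit_refl _ _ _)).
by move=> /(mem_CycP K_Aut).
Qed.

Variables (n1 n2 m n : nat) (B1 : {set {set 'Z_n1}}) (B2 : {set {set 'Z_n2}}).
Variable B : {set {set 'Z_n}}.
Hypothesis wreath : is_gwreath n1 n2 m n B1 B2 B.

Lemma same_class_quo a b :
  same_class B a b -> same_class B2 (Zquo n n2 a) (Zquo n n2 b).
Proof.
case: wreath => [[[[_ [pB2 _ _ _]] _ _ _ _] _] [pB _ _ _] _ [_ quoB] _] ab Y YB aY.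
have [X XB aX] := partition_class a pB.
have im c : c \in X -> Zquo n n2 c \in Zquo n n2 @: X by apply: imset_f.
have XB2 : Zquo n n2 @: X \in B2 by rewrite -quoB; apply: imset_f.
by rewrite (partition_eq pB2 YB XB2 aY (im a aX)) im //; apply: ab XB aX.
Qed.

Lemma same_class_sub a b : 1 < n1 -> 0 < n -> n1 %| n ->
  same_class B (Zemb n1 n a) b -> exists2 b', b = Zemb n1 n b' & same_class B1 a b'.
Proof.
case: wreath => [[[[[pB1 _ _ _] _] _ _ _ _] _] [pB _ _ _] _ [restrB _] _] n1_gt1 n_gt0 n1n ab.
have [X XB aX] := partition_class a pB1.
have: X \in sring_restr n n1 B by rewrite restrB.
move=> /imsetP[Z]; rewrite inE => /andP[ZB ZU] eX.
have bZ : b \in Z by apply: ab ZB _; rewrite eX inE in aX.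
have := subsetP ZU _ bZ; rewrite -codom_Zemb_Zsub // => /codomP[b' eb].
exists b' => // Y YB aY.
by rewrite (partition_eq pB1 YB XB aY aX) eX inE -eb.
Qed.

End Schurian.

(** * Parts of integers and cancellation in congruences *)

Lemma part_coprime p e k : prime p -> 0 < k -> coprime p k -> (p ^ e * k)`_p = p ^ e.
Proof.
move=> p_pr k_gt0 pk; have pe_gt0 : 0 < p ^ e by rewrite expn_gt0 prime_gt0.
rewrite p_part (lognM _ pe_gt0 k_gt0) (pfactorK _ p_pr).
by rewrite logn_coprime // addn0.
Qed.

Lemma modn_mul_cancel k c a b : 1 < k -> coprime k c ->
  a * c = b * c %[mod k] -> a = b %[mod k].
Proof.
move=> k_gt1 kc /(natr_eqP _ _ k_gt1); rewrite !natrM => e.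
apply/(natr_eqP _ _ k_gt1); apply: mulIr e; by rewrite unitZpE.
Qed.

Lemma modn_add_mul_cancel k a b x y :
  a + x * k = b + y * k %[mod k] -> a = b %[mod k].
Proof. by rewrite ![_ + _ * k]addnC !modnMDl. Qed.

(** Moving the subtracted terms across keeps everything within the natural numbers, where reduction
    modulo divisors of [n] is direct. *)
Lemma natr_subr_eq n a b t c e : 1 < n ->
  (a%:R - b%:R = t%:R * (c%:R - e%:R) :> 'Z_n)%R -> a + t * e = t * c + b %[mod n].
Proof.
move=> n_gt1 E; apply/(natr_eqP _ _ n_gt1); rewrite !natrD !natrM.
by move: E; rewrite mulrBr => /eqP; rewrite subr_eq addrAC eq_sym subr_eq eq_sym => /eqP ->.
Qed.

(** * Non-schurity of the iterated wreath product *)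

Section NonSchurian.
Variables (p p3 q : nat) (M : {group {perm 'Z_(p ^ 2 * p3)}}).
Variables M1 M2 : {group {perm 'Z_(p * q)}}.
Variables (A2 : {set {set 'Z_(p ^ 2 * q)}}) (A : {set {set 'Z_(p ^ 2 * p3 * q)}}).
Hypotheses (p_pr : prime p) (p3_pr : prime p3) (q_pr : prime q).
Hypotheses (p_neq_p3 : p != p3) (p_neq_q : p != q).
Hypothesis M_Aut : M \subset Aut [set: 'Z_(p ^ 2 * p3)].
Hypothesis M1_Aut : M1 \subset Aut [set: 'Z_(p * q)].
Hypothesis M2_Aut : M2 \subset Aut [set: 'Z_(p * q)].
Hypothesis A2_wreath :
  is_gwreath (p * q) (p * q) q (p ^ 2 * q) (Cyc (p * q) M1) (Cyc (p * q) M2) A2.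
Hypothesis A_wreath : is_gwreath (p ^ 2 * p3) (p ^ 2 * q) (p ^ 2) (p ^ 2 * p3 * q)
  (Cyc (p ^ 2 * p3) M) A2 A.
Hypothesis M_p : residues M1 p \subset residues M p.
Hypothesis M_inj : {in M &, forall s t : {perm 'Z_(p ^ 2 * p3)},
  Zquo (p ^ 2 * p3) p (s 1%R) = Zquo (p ^ 2 * p3) p (t 1%R) ->
  Zquo (p ^ 2 * p3) p3 (s 1%R) = Zquo (p ^ 2 * p3) p3 (t 1%R) -> s = t}.
Hypothesis M1_inj :
  {in M1 &, injective (fun s : {perm 'Z_(p * q)} => Zquo (p * q) p (s 1%R))}.

(** An inclusion suffices for the contradiction, as the two groups have equal order in the
    theorem. *)
Lemma schurian_sub : schurian A -> M1 \subset M2.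
Proof.
move=> schA; have p_gt1 := prime_gt1 p_pr; have p3_gt1 := prime_gt1 p3_pr.
have q_gt1 := prime_gt1 q_pr; have p_gt0 := ltnW p_gt1.
have p3_gt0 := ltnW p3_gt1; have q_gt0 := ltnW q_gt1.
have p2_gt0 : 0 < p ^ 2 by rewrite expn_gt0 p_gt0.
have p_p2 : p %| p ^ 2 by rewrite expnS dvdn_mulr.
have n1_gt0 : 0 < p ^ 2 * p3 by rewrite muln_gt0 p2_gt0.
have p_n1 : p %| p ^ 2 * p3 by rewrite dvdn_mulr.
have p3_n1 : p3 %| p ^ 2 * p3 by rewrite dvdn_mull.
have n1_gt1 := leq_trans p_gt1 (dvdn_leq n1_gt0 p_n1).
have n_gt0 : 0 < p ^ 2 * p3 * q by rewrite muln_gt0 n1_gt0.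
have n1_n : p ^ 2 * p3 %| p ^ 2 * p3 * q by rewrite dvdn_mulr.
have n2_n : p ^ 2 * q %| p ^ 2 * p3 * q by rewrite mulnAC dvdn_mulr.
have n2_gt0 : 0 < p ^ 2 * q by rewrite muln_gt0 p2_gt0.
have pq_gt0 : 0 < p * q by rewrite muln_gt0 p_gt0.
have p_pq : p %| p * q by rewrite dvdn_mulr.
have q_pq : q %| p * q by rewrite dvdn_mull.
have pq_gt1 := leq_trans p_gt1 (dvdn_leq pq_gt0 p_pq).
have n2_def : p ^ 2 * q = p * (p * q) by rewrite expnS expn1 mulnA.
have pq_n2 : p * q %| p ^ 2 * q by rewrite n2_def dvdn_mull.
have n2_gt1 := leq_trans pq_gt1 (dvdn_leq n2_gt0 pq_n2).
have n_n1 : p ^ 2 * p3 * q %/ (p ^ 2 * p3) = q by rewrite mulKn.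
have n2_pq : p ^ 2 * q %/ (p * q) = p by rewrite n2_def mulnK.
have cop3 : coprime p p3 by rewrite prime_coprime // dvdn_prime2.
have copq : coprime p q by rewrite prime_coprime // dvdn_prime2.
apply/subsetP=> s0 s0M.
(* The multiplier [m] is chosen to agree modulo [p] with the given [s0] of [M1]. *)
have /imsetP[m mM em] := subsetP M_p _ (mem_residues p s0M).
set iota := Zemb (p ^ 2 * p3) (p ^ 2 * p3 * q).
set pi := Zquo (p ^ 2 * p3 * q) (p ^ 2 * q).
set iota2 := Zemb (p * q) (p ^ 2 * q).
set pi2 := Zquo (p ^ 2 * q) (p * q).
have morphB (k l : nat) (f : 'Z_k -> 'Z_l) : {morph f : x y / (x * y)%g} ->
    {morph f : x y / (x - y)%R}.
  by move=> fM x y; rewrite -FinRing.zmodVgE -FinRing.zmodMgE fM (morph_V fM).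
have iotaB := morphB _ _ _ (Zemb_add n1_gt1 n_gt0 n1_n).
have piB := morphB _ _ _ (Zquo_add n2_gt1 n_gt0 n2_n).
have iota2B := morphB _ _ _ (Zemb_add pq_gt1 n2_gt0 pq_n2).
have pi2B := morphB _ _ _ (Zquo_add pq_gt1 n2_gt0 pq_n2).
have A_sring : is_sring A by case: A_wreath.
have restrA : sring_restr _ (p ^ 2 * p3) A = Cyc _ M by case: A_wreath => _ _ _ [].
have : orbit 'P M 1%R \in sring_restr _ (p ^ 2 * p3) A by rewrite restrA orbit_Cyc.
case/imsetP=> Z; rewrite inE => /andP[ZA _] eZ.
have oneZ : iota 1%R \in Z.
  by have := orbit_refl 'P M (1%R : 'Z_(p ^ 2 * p3)); rewrite eZ inE.
have mZ : iota (m 1%R) \in Z.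
  have : m 1%R \in orbit 'P M 1%R by apply/(mem_CycP M_Aut); exists m; rewrite ?mulr1.
  by rewrite eZ inE.
have [g [g0 g1 gS]] := schurian_automorphism A_sring schA ZA oneZ mZ.
have gB x y : same_class A (x - y)%R (g x - g y)%R by exact: gS y x.
have {}g0 : g 0%R = 0%R by exact: g0.
(* An element of order [p]; it vanishes modulo [p] and modulo [p3], so both reductions of [em2]
   compare [m2] with [m] alone. *)
pose P : 'Z_(p ^ 2 * p3) := (p * p3)%:R%R.
have [P' gP [m' m'M eP']] : exists2 P', g (iota P) = iota P' &
    exists2 m', m' \in M & P' = (m' 1 * P)%R.
  have /(same_class_sub A_wreath n1_gt1 n_gt0 n1_n)[P' gP PP'] :
      same_class A (iota P) (g (iota P)).
    by have := gB (iota P) 0%R; rewrite g0 !subr0.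
  by exists P' => //; apply: same_class_Cyc PP'.
have [m2 m2M em2] : exists2 m2, m2 \in M & (P' - m 1 = m2 1 * (P - 1))%R.
  have := gB (iota P) (iota 1%R); rewrite gP g1 -!iotaB.
  case/(same_class_sub A_wreath n1_gt1 n_gt0 n1_n) => b.
  by move=> /(Zemb_inj n1_gt1 n_gt0 n1_n) ->; apply: same_class_Cyc.
have m2_mod k : 1 < k -> k %| p ^ 2 * p3 -> k %| p * p3 ->
    Zquo (p ^ 2 * p3) k (m2 1%R) = Zquo (p ^ 2 * p3) k (m 1%R).
  move=> k_gt1 kn1 kP; have P0 : Zquo (p ^ 2 * p3) k P = 0%R.
    by rewrite Zquo_nat //; apply/(natr_eqP _ 0 k_gt1)/eqP; rewrite mod0n.
  have ZB := morphB _ _ _ (Zquo_add k_gt1 n1_gt0 kn1).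
  move/(congr1 (Zquo (p ^ 2 * p3) k)): em2.
  rewrite Zquo_mul // !ZB eP' Zquo_mul // P0 mulr0 !sub0r.
  by rewrite (Zquo_nat k_gt1 n1_gt0 kn1 1) mulrN1 => /oppr_inj.
have m2m : m2 = m.
  apply: (M_inj m2M mM); first by apply: m2_mod => //; apply: dvdn_mulr.
  by apply: m2_mod => //; apply: dvdn_mull.
have {}gP : g (iota P) = (m 1%R * (p * p3) * q)%:R%R.
  rewrite gP; have -> : P' = (m 1 * P)%R.
    by move/eqP: em2; rewrite m2m mulrBr mulr1 subr_eq subrK => /eqP.
  by rewrite -[m 1%R]natr_Zp -natrM /iota Zemb_nat // n_n1 natr_Zp.
have gm : g (iota 1%R) = (m 1%R * q)%:R%R.
  by rewrite g1 -[in LHS](natr_Zp (m 1%R)) /iota Zemb_nat // n_n1.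
have dB x y : same_class A2 (pi x - pi y)%R (pi (g x) - pi (g y))%R.
  by rewrite -!piB; apply: (same_class_quo A_wreath).
(* Only its image under [pi] matters, and that image has order [q]. *)
pose Q : 'Z_(p ^ 2 * p3 * q) := (p ^ 2)%:R%R.
have piQ : pi Q = iota2 p%:R%R by rewrite /pi /iota2 Zquo_nat // Zemb_nat // n2_pq mulnn.
have [a gQ [s sM ea]] : exists2 a, pi (g Q) = iota2 a &
    exists2 s, s \in M1 & a = (s 1%R * p)%:R%R.
  have := dB Q 0%R; rewrite g0 piQ.
  have -> : pi 0%R = 0%R by exact: (Zquo_nat n2_gt1 n_gt0 n2_n 0).
  rewrite !subr0.
  case/(same_class_sub A2_wreath pq_gt1 n2_gt0 pq_n2) => a gQ.
  case/(same_class_Cyc M1_Aut) => s sM ea; exists a => //; exists s => //.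
  by rewrite ea natrM natr_Zp.
(* The images of [Q] and [iota P] both lie in the subgroup of order [p * q], so their difference
   moves inside a class of [Cyc (p * q) M1]. *)
have [t tM et] : exists2 t, t \in M1 &
    (a - (m 1 * p3 * q)%:R = t 1 * (p%:R - (p3 * q)%:R))%R.
  have := dB Q (iota P); rewrite gQ piQ gP.
  have -> : pi (m 1 * (p * p3) * q)%:R%R = iota2 (m 1 * p3 * q)%:R%R.
    rewrite /pi /iota2 Zquo_nat // Zemb_nat // n2_pq; congr (_%:R)%R.
    by rewrite [p * p3]mulnC mulnA mulnAC.
  have -> : pi (iota P) = iota2 (p3 * q)%:R%R.
    rewrite /pi /iota /iota2 /P Zemb_nat // n_n1 Zquo_nat // Zemb_nat // n2_pq.
    by congr (_%:R)%R; rewrite -mulnA mulnC.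
  rewrite -!iota2B => /(same_class_sub A2_wreath pq_gt1 n2_gt0 pq_n2)[b].
  by move=> /(Zemb_inj pq_gt1 n2_gt0 pq_n2) ->; apply: same_class_Cyc.
(* The generator of [U] lies outside that subgroup, so its difference with [Q] is taken in the
   quotient of order [p * q], where [M2] acts. *)
have [r rM er] : exists2 r, r \in M2 &
    ((s 1 * p * p)%:R - (m 1 * q)%:R = r 1 * ((p ^ 2)%:R - q%:R) :> 'Z_(p * q))%R.
  have := same_class_quo A2_wreath (dB Q (iota 1%R)).
  move/(same_class_Cyc M2_Aut) => [r rM]; rewrite gQ gm ea !pi2B => er.
  exists r => //; move: er; rewrite /pi /iota2 /iota (Zemb_nat n1_gt1 n_gt0 n1_n 1).
  by rewrite !Zquo_nat // Zemb_nat // n2_pq n_n1 mul1n Zquo_nat.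
have pq_sub k x y : k %| p * q -> x = y %[mod p * q] -> x = y %[mod k].
  by move=> kpq e; rewrite -(modn_dvdm x kpq) e modn_dvdm.
rewrite ea -(natr_Zp (t 1%R)) in et; rewrite -(natr_Zp (r 1%R)) in er.
move/(natr_subr_eq pq_gt1): et => et; move/(natr_subr_eq pq_gt1): er => er.
have p2E k : k * p ^ 2 = k * p * p by rewrite -mulnA mulnn.
rewrite p2E in er.
(* Reducing [et] and [er] modulo [p] and modulo [q] kills all but one term on each side and leaves
   an invertible factor to cancel. As a result [t] and [r] both agree with [m] modulo [p] and with
   [s] modulo [q]. *)
have tm : t 1%R = m 1%R %[mod p].
  apply: (@modn_mul_cancel _ (p3 * q)) => //; first by rewrite coprimeMr cop3.
  by have := pq_sub p _ _ p_pq et; rewrite modnMDl mulnC modnMDl mulnA.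
have st : s 1%R = t 1%R %[mod q].
  apply: (@modn_mul_cancel _ p) => //; first by rewrite coprime_sym.
  by have := pq_sub q _ _ q_pq et; rewrite mulnA; apply: modn_add_mul_cancel.
have rm : r 1%R = m 1%R %[mod p].
  apply: (@modn_mul_cancel _ q) => //.
  by have := pq_sub p _ _ p_pq er; rewrite !modnMDl.
have sr : s 1%R = r 1%R %[mod q].
  apply: (@modn_mul_cancel _ (p * p)) => //; first by rewrite coprimeMr coprime_sym copq.
  by have := pq_sub q _ _ q_pq er; rewrite !mulnA; apply: modn_add_mul_cancel.
have ts0 : t = s0.
  apply: M1_inj => //=; rewrite em /Zquo -!Zp_nat.
  exact/(natr_eqP _ _ p_gt1).
suff <- : r = s0 by [].
rewrite -ts0; apply/permP=> x.
rewrite (Aut_mul _ (subsetP M1_Aut _ tM)) (Aut_mul _ (subsetP M2_Aut _ rM)).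
congr (_ * _)%R; rewrite -[LHS]natr_Zp -[RHS]natr_Zp; apply/(natr_eqP _ _ pq_gt1)/eqP.
by rewrite chinese_remainder // rm -tm -st sr !eqxx.
Qed.

End NonSchurian.

(** * Well-definedness of both wreath products, and non-schurity *)

Theorem theorem12p1 (p p3 p4 d : nat)
    (p_prime : prime p) (p3_prime : prime p3) (p4_prime : prime p4)
    (p_neq_p4 : p != p4) (p_dvd_p3 : p %| p3 - 1)
    (d_gt0 : 0 < d) (d_dvd_p : d %| p - 1) (d_dvd_p4 : d %| p4 - 1)
    (M : {group {perm 'Z_(p ^ 2 * p3)}})
    (M_Aut : M \subset Aut [set: 'Z_(p ^ 2 * p3)])
    (M_cyclic : cyclic M) (M_card : #|M| = p * d)
    (M_p : #|Aut_proj (p ^ 2 * p3) p M| = p * d)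
    (M_p3 : #|Aut_proj (p ^ 2 * p3) p3 M| = p)
    (M1 M2 : {group {perm 'Z_(p * p4)}})
    (M1_Aut : M1 \subset Aut [set: 'Z_(p * p4)])
    (M2_Aut : M2 \subset Aut [set: 'Z_(p * p4)])
    (M1_cyclic : cyclic M1) (M2_cyclic : cyclic M2)
    (M1_card : #|M1| = d) (M2_card : #|M2| = d)
    (M1_p : #|Aut_proj (p * p4) p M1| = d)
    (M1_p4 : #|Aut_proj (p * p4) p4 M1| = d)
    (M2_p : #|Aut_proj (p * p4) p M2| = d)
    (M2_p4 : #|Aut_proj (p * p4) p4 M2| = d)
    (M1_neq_M2 : M1 != M2) :
  exists (A2 : {set {set 'Z_(p ^ 2 * p4)}})
         (A : {set {set 'Z_(p ^ 2 * p3 * p4)}}),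
    [/\ unique (is_gwreath (p * p4) (p * p4) p4 (p ^ 2 * p4)
                  (Cyc (p * p4) M1) (Cyc (p * p4) M2)) A2,
        unique (is_gwreath (p ^ 2 * p3) (p ^ 2 * p4) (p ^ 2) (p ^ 2 * p3 * p4)
                  (Cyc (p ^ 2 * p3) M) A2) A &
        ~ schurian A].
Proof.
have p_gt1 := prime_gt1 p_prime; have p_gt0 := ltnW p_gt1.
have p3_gt1 := prime_gt1 p3_prime; have p3_gt0 := ltnW p3_gt1.
have p4_gt1 := prime_gt1 p4_prime; have p4_gt0 := ltnW p4_gt1.
have p_neq_p3 : p != p3.
  apply: contraTneq p_dvd_p3 => <-.
  by rewrite -(eqn_mod_dvd p p_gt0) modnn modn_small.
have p2_gt0 : 0 < p ^ 2 by rewrite expn_gt0 p_gt0.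
have p_p2 : p %| p ^ 2 by rewrite expnS dvdn_mulr.
have p2_gt1 : 1 < p ^ 2 := leq_trans p_gt1 (dvdn_leq p2_gt0 p_p2).
have pp4_gt0 : 0 < p * p4 by rewrite muln_gt0 p_gt0.
have n1_gt0 : 0 < p ^ 2 * p3 by rewrite muln_gt0 p2_gt0.
have n2_gt0 : 0 < p ^ 2 * p4 by rewrite muln_gt0 p2_gt0.
have cop3 : coprime p p3 by rewrite prime_coprime // dvdn_prime2.
have cop4 : coprime p p4 by rewrite prime_coprime // dvdn_prime2.
have pp4_p : (p * p4)`_p = p by rewrite -{1}(expn1 p) part_coprime.
have pp4_p4 : (p * p4)`_p4 = p4.
  by rewrite mulnC -{1}(expn1 p4) part_coprime // coprime_sym.
have n1_p : (p ^ 2 * p3)`_p = p ^ 2 by rewrite part_coprime.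
have n1_p3 : (p ^ 2 * p3)`_p3 = p3.
  by rewrite mulnC -{1}(expn1 p3) part_coprime // coprime_sym coprime_pexpl.
have R1p := prime_residues M1_Aut p_prime pp4_gt0 d_gt0 pp4_p M1_card M1_p.
have R2p := prime_residues M2_Aut p_prime pp4_gt0 d_gt0 pp4_p M2_card M2_p.
have R1p4 := prime_residues M1_Aut p4_prime pp4_gt0 d_gt0 pp4_p4 M1_card M1_p4.
have R2p4 := prime_residues M2_Aut p4_prime pp4_gt0 d_gt0 pp4_p4 M2_card M2_p4.
have RM := square_residues M_Aut p_prime n1_gt0 d_gt0 n1_p M_card M_p.
have R12 : residues M1 p4 = residues M2 p4 by rewrite R1p4.
set B2 := Zwreath p4 (p ^ 2 * p4) (Cyc (p * p4) M1) (Cyc (p * p4) M2).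
have B2_unique : unique (is_gwreath (p * p4) (p * p4) p4 (p ^ 2 * p4)
    (Cyc (p * p4) M1) (Cyc (p * p4) M2)) B2 by exact: Cyc_wreath_unique.
(* On both sides the classes over ['Z_(p ^ 2)] are the orbits of the residues that reduce modulo [p]
   to [d]-th roots of unity. *)
have compat : gwreath_compat (p ^ 2 * p3) (p ^ 2 * p4) (p ^ 2) (Cyc (p ^ 2 * p3) M) B2.
  split; [split; [exact: Cyc_sring | exact: Cyc_wreath_sring]
         | by split; apply: dvdn_mulr | exact: sring_subgroup_Cyc
         | exact: Cyc_wreath_subgroup |].
  rewrite /B2 (Cyc_wreath_restr p_prime p4_prime p_neq_p4 M1_Aut M2_Aut R12 R1p R2p).
  by rewrite (sring_quo_Cyc M_Aut p2_gt1 n1_gt0 (dvdn_mulr _ (dvdnn _))) RM.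
have n_def : p ^ 2 * p3 * p4 = p ^ 2 * p3 * (p ^ 2 * p4) %/ p ^ 2.
  by rewrite [_ * (_ * p4)]mulnCA mulKn.
have B_unique := Zwreath_unique p2_gt1 n1_gt0 n2_gt0 compat n_def.
exists B2, (Zwreath (p ^ 2) (p ^ 2 * p3 * p4) (Cyc (p ^ 2 * p3) M) B2); split=> //.
move=> schA; case/negP: M1_neq_M2; apply/eqP/val_inj/eqP => /=.
rewrite eqEcard M1_card M2_card leqnn andbT.
apply: (schurian_sub p_prime p3_prime p4_prime p_neq_p3 p_neq_p4 M_Aut M1_Aut M2_Aut
  (proj1 B2_unique) (proj1 B_unique) _ _ _ schA).
(* By [RM] every lift to ['Z_(p ^ 2)] of a [d]-th root of unity modulo [p] is a residue of [M]; the
   least representative of [r] is one such lift. *)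
- apply/subsetP=> r; rewrite R1p => rR.
  have : Zquo p (p ^ 2) r \in residues M (p ^ 2) by rewrite RM inE Zquo_sectK.
  case/imsetP=> m mM rm; rewrite -(Zquo_sectK p_gt1 p2_gt0 p_p2 r) rm.
  by rewrite Zquo_trans ?mem_residues // dvdn_mulr.
- exact: (square_residues_inj M_Aut p_prime n1_gt0 (dvdn_mull _ (dvdnn _)) p3_gt1
    n1_p n1_p3 d_dvd_p M_card).
- apply: (residues_inj M1_Aut p_gt1 pp4_gt0 _ pp4_p); first exact: dvdn_mulr.
  by rewrite M1_p.
Qed.
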